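(* Assume (G0)–(G4). Let $W$ be a random vector in $\mathbb Z^d$ such that, for some $\varepsilon,v>0$, (i) $\mathbb E|W-nc|_\Sigma^2\le dvn$ and (ii) $d_{\mathrm{TV}}(\mathcal L(W),\mathcal L(W+e^{(j)}))\le\varepsilon$ for each $1\le j\le d$. Then for any $\delta\le\delta_0/\sqrt{\lambda_{\max}(\Sigma)}$, any $0<\delta'\le\delta/2$, any $h:\mathbb Z^d\to\mathbb R$, and $n\ge\max\{n_3,\psi^{-1}(\delta/2)\}$, $$\bigl|\mathbb E\{(\mathcal A_n^\delta h(W)-\widetilde{\mathcal A}_nh(W))\mathbf 1[|W-nc|_\Sigma\le n\delta'/3]\}\bigr|\le d^{5/2}\bar\Lambda\Bigl(\tfrac12L_2\lambda_{\max}(\Sigma)v\|\Delta h\|^\Sigma_{n\delta/4,\infty}+n\|\Delta^2h\|^\Sigma_{n\delta/4,\infty}\Bigl\{L_1\sqrt{v\lambda_{\max}(\Sigma)}\,n^{-1/2}+d^{1/2}(\bar\gamma/\bar\Lambda)\varepsilon+\frac{32d^{1/2}v}{n(\delta')^2}\Bigr\}\Bigr).$$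
   Context: Fix integers $d\ge1$, $n\ge d^4$ (standing assumption). Let $\mathcal J\subset\mathbb Z^d$ be finite, $g^J:\mathbb R^d\to[0,\infty)$ for $J\in\mathcal J$ (set $g^J:=0$ for $J\notin\mathcal J$), $F(\xi):=\sum_JJg^J(\xi)$, $\sigma^2(x):=\sum_JJJ^Tg^J(x)$. Fix $c\in\mathbb R^d$, $\delta_0>0$, $B_{\delta_0}(c):=\{x:|x-c|\le\delta_0\}$. Assumptions: (G0) $F(c)=0$; (G1) all eigenvalues of $A:=DF(c)$ have negative real part; (G2) each $g^J$ is $C^2$ on $B_{\delta_0}(c)$; (G3) there is $\varepsilon_0>0$ with $\inf_{B_{\delta_0}(c)}g^J\ge\varepsilon_0g^J(c)>0$ for all $J\in\mathcal J$; (G4) each $e^{(j)}$ is a finite sum of elements of $\mathcal J$. Let $\sigma^2:=\sigma^2(c)$, $\Sigma$ the positive definite symmetric solution of $A\Sigma+\Sigma A^T+\sigma^2=0$, $|Y|_\Sigma:=(Y^T\Sigma^{-1}Y)^{1/2}$, $\widetilde B_{n,\delta}(c):=\{X\in\mathbb Z^d:|X-nc|_\Sigma\le n\delta\}$. Generator of the restricted process: $\mathcal A_n^\delta h(X):=n\sum_Jg^J_\delta(n^{-1}X)\{h(X+J)-h(X)\}$, with $g^J_\delta(n^{-1}X)=g^J(n^{-1}X)$ if $X,X+J\in\widetilde B_{n,\delta}(c)$ and $0$ otherwise. Simplified operator: $\widetilde{\mathcal A}_nh(w):=\frac n2\mathrm{Tr}(\sigma^2\Delta^2h(w))+\Delta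 h(w)^TA(w-nc)$, where $\Delta_jh(w):=h(w+e^{(j)})-h(w)$, $\Delta_{jk}h:=\Delta_j\Delta_kh$, $\Delta h=(\Delta_jh)_j$, $\Delta^2h=(\Delta_{jk}h)_{jk}$. Norms: $\|\Delta h\|^\Sigma_{a,\infty}:=\max\{\max_j|\Delta_jh(X)|:|X-nc|_\Sigma\le a\}$, $\|\Delta^2h\|^\Sigma_{a,\infty}:=\max\{\max_{j,k}|\Delta_{jk}h(X)|:|X-nc|_\Sigma\le a\}$. Notation: $\lambda_{\min},\lambda_{\max}$ extreme eigenvalues, $\rho(M):=\lambda_{\max}(M)/\lambda_{\min}(M)$; $L_0,L_1,L_2$ are $\max_J\sup_{B_{\delta_0}(c)}$ of $g^J,|Dg^J|,\|D^2g^J\|$ divided by $g^J(c)$; $\bar\Lambda:=d^{-1}\mathrm{Tr}(\sigma^2)$; $\bar\gamma:=d^{-3/2}\sum_Jg^J(c)|J|^3$; $J^\Sigma_{\max}:=\max_J|\Sigma^{-1/2}J|$; $\sigma^2_\Sigma:=\Sigma^{-1/2}\sigma^2\Sigma^{-1/2}$; $\alpha_1:=\frac12\lambda_{\min}(\sigma^2_\Sigma)$; $K_*:=(2L_0\mathrm{Tr}(\sigma^2_\Sigma)/(d\alpha_1))^{1/2}$; $\delta_*:=\delta_0/\sqrt{\lambda_{\max}(\Sigma)}$; $\theta_1:=d^{-1}\min\{1/(3d^{-1}J^\Sigma_{\max}\delta_* ),1/(64L_0\rho(\sigma^2)\rho(\Sigma)),1/(4(d^{-1}J^\Sigma_{\max})^2)\}$;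 $n_*:=(d^{-1}J^\Sigma_{\max}/\delta_* )^{4/3}$; $K_2:=L_0\exp\{\theta_1(K_*+d^{-1}J^\Sigma_{\max})^2\}$; $n_2(T):=\max\{K_2\bar\Lambda T,n_*\}$; $\psi(m):=4\sqrt{\log m/((d\theta_1)m^{3/4})}$, $\psi^{-1}(\eta):=\min\{m\ge4:\psi(m)\le\eta\}$; $g^{(j)}:=g^{-e^{(j)}}(c)$; $I^{(j)}:=\{i:A_{ij}\ne0\}$; $G^{(j)}:=\sum_{i\in I^{(j)}}g^{e^{(i)}}(c)$; $g_*:=\min_j\min\{g^{(j)},G^{(j)}\}$; $n_3:=\max\{(5d^{-1}J^\Sigma_{\max}\max\{1,\sqrt{d\theta_1}\})^{8/3},n_2(1/g_* )\}$. *)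

(* Defs.v *)
From mathcomp Require Import all_boot all_order all_algebra.
From mathcomp Require Import all_classical all_reals all_analysis.
From mathcomp Require Import complex.
Set Implicit Arguments. Unset Strict Implicit. Unset Printing Implicit Defensive.
Import Order.TTheory GRing.Theory Num.Theory.
Import numFieldNormedType.Exports.
Local Open Scope ring_scope.
Local Open Scope classical_set_scope.

Section Defs.
Variables (R : realType) (d : nat).

Definition toR (X : 'cV[int]_d) : 'cV[R]_d := map_mx (fun z : int => z%:~R) X.
Definition eZ (j : 'I_d) : 'cV[int]_d := delta_mx j 0.
Definition eR (j : 'I_d) : 'cV[R]_d := delta_mx j 0.

Definition enorm (v : 'cV[R]_d) : R := Num.sqrt (\sum_(i < d) v i 0 ^+ 2).
Definition snorm (Sig : 'M[R]_d) (Y : 'cV[R]_d) : R :=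
  Num.sqrt ((Y^T *m invmx Sig *m Y) 0 0).
Definition cball (c : 'cV[R]_d) (r : R) : set 'cV[R]_d :=
  [set x | enorm (x - c) <= r].

Definition symmx (M : 'M[R]_d) : Prop := M^T = M.
Definition posdef (M : 'M[R]_d) : Prop :=
  forall x : 'cV[R]_d, x != 0 -> 0 < (x^T *m M *m x) 0 0.
(* extreme (real) eigenvalues; used only for symmetric matrices *)
Definition lam_max (M : 'M[R]_d) : R := sup [set a : R | eigenvalue M a].
Definition lam_min (M : 'M[R]_d) : R := inf [set a : R | eigenvalue M a].
Definition rho (M : 'M[R]_d) : R := lam_max M / lam_min M.
Definition hurwitz (A : 'M[R]_d) : Prop :=
  forall z : R[i], root (map_poly (real_complex R) (char_poly A)) z ->
    complex.Re z < 0.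
Definition opnorm (M : 'M[R]_d) : R :=
  sup [set enorm (M *m x) | x in [set x | enorm x = 1]].

Definition partial (f : 'cV[R]_d -> R) (i : 'I_d) (x : 'cV[R]_d) : R :=
  'D_(eR i) f x.
Definition grad (f : 'cV[R]_d -> R) (x : 'cV[R]_d) : 'cV[R]_d :=
  \col_i partial f i x.
Definition hess (f : 'cV[R]_d -> R) (x : 'cV[R]_d) : 'M[R]_d :=
  \matrix_(i, j) partial (partial f j) i x.
Definition C2_on (B : set 'cV[R]_d) (f : 'cV[R]_d -> R) : Prop :=
  exists U : set 'cV[R]_d, open U /\ B `<=` U /\
    forall x, U x ->
      [/\ differentiable f x,
          (forall i, differentiable (partial f i) x) &
          (forall i j, {for x, continuous (partial (partial f i) j)})].

(* Js : the finite set J (a duplicate-free list), g J : the rate functions *)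
Definition Fdrift (Js : seq 'cV[int]_d) (g : 'cV[int]_d -> 'cV[R]_d -> R)
  (x : 'cV[R]_d) : 'cV[R]_d := \sum_(J <- Js) g J x *: toR J.
Definition sigma2 (Js : seq 'cV[int]_d) (g : 'cV[int]_d -> 'cV[R]_d -> R)
  (x : 'cV[R]_d) : 'M[R]_d := \sum_(J <- Js) g J x *: (toR J *m (toR J)^T).
(* Jacobian DF(c): (DF)_{ij} = d F_i / d x_j *)
Definition DF (Js : seq 'cV[int]_d) (g : 'cV[int]_d -> 'cV[R]_d -> R)
  (c : 'cV[R]_d) : 'M[R]_d :=
  \matrix_(i, j) \sum_(J <- Js) (toR J i 0 * partial (g J) j c).
Definition gext (Js : seq 'cV[int]_d) (g : 'cV[int]_d -> 'cV[R]_d -> R)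
  (J : 'cV[int]_d) (x : 'cV[R]_d) : R := if J \in Js then g J x else 0.

Definition Agen (Js : seq 'cV[int]_d) (g : 'cV[int]_d -> 'cV[R]_d -> R)
  (Sig : 'M[R]_d) (c : 'cV[R]_d) (n : nat) (delta : R)
  (h : 'cV[int]_d -> R) (X : 'cV[int]_d) : R :=
  n%:R * \sum_(J <- Js)
    ((if (snorm Sig (toR X - n%:R *: c) <= n%:R * delta) &&
         (snorm Sig (toR (X + J) - n%:R *: c) <= n%:R * delta)
      then g J (n%:R^-1 *: toR X) else 0) * (h (X + J) - h X)).

Definition D1 (h : 'cV[int]_d -> R) (j : 'I_d) (X : 'cV[int]_d) : R :=
  h (X + eZ j) - h X.
Definition D2 (h : 'cV[int]_d -> R) (j k : 'I_d) (X : 'cV[int]_d) : R :=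
  D1 (D1 h k) j X.
Definition D1vec (h : 'cV[int]_d -> R) (X : 'cV[int]_d) : 'cV[R]_d :=
  \col_j D1 h j X.
Definition D2mat (h : 'cV[int]_d -> R) (X : 'cV[int]_d) : 'M[R]_d :=
  \matrix_(j, k) D2 h j k X.

Definition Atil (s2 A : 'M[R]_d) (c : 'cV[R]_d) (n : nat)
  (h : 'cV[int]_d -> R) (w : 'cV[int]_d) : R :=
  n%:R / 2 * \tr (s2 *m D2mat h w)
  + ((D1vec h w)^T *m A *m (toR w - n%:R *: c)) 0 0.

Definition normD1 (Sig : 'M[R]_d) (c : 'cV[R]_d) (n : nat)
  (h : 'cV[int]_d -> R) (a : R) : R :=
  sup [set r : R | exists (X : 'cV[int]_d) (j : 'I_d),
        snorm Sig (toR X - n%:R *: c) <= a /\ r = `|D1 h j X|].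
Definition normD2 (Sig : 'M[R]_d) (c : 'cV[R]_d) (n : nat)
  (h : 'cV[int]_d -> R) (a : R) : R :=
  sup [set r : R | exists (X : 'cV[int]_d) (j k : 'I_d),
        snorm Sig (toR X - n%:R *: c) <= a /\ r = `|D2 h j k X|].

Definition is_pmf (p : 'cV[int]_d -> R) : Prop :=
  (forall x, 0 <= p x) /\ (\esum_(x in [set: 'cV[int]_d]) (p x)%:E = 1)%E.
Definition probp (p : 'cV[int]_d -> R) (A : set 'cV[int]_d) : \bar R :=
  (\esum_(x in A) (p x)%:E)%E.
Definition dTV (p q : 'cV[int]_d -> R) : \bar R :=
  ereal_sup [set `|(probp p A - probp q A)%E|%E | A in [set: set 'cV[int]_d]].
(* law of W + e^{(j)} when W has law p *)
Definition shift_pmf (p : 'cV[int]_d -> R) (j : 'I_d) : 'cV[int]_d -> R :=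
  fun x => p (x - eZ j).

End Defs.

Section Constants.
Variables (R : realType) (d : nat).

Definition psi (th1 : R) (m : nat) : R :=
  4 * Num.sqrt (ln (m%:R) / ((d%:R * th1) * powR (m%:R) (3 / 4))).
Definition psi_inv (th1 eta : R) : R :=
  inf [set (m%:R : R) | m in [set m : nat | (4 <= m)%N /\ psi th1 m <= eta]].

End Constants.

Arguments toR {R d} X.
Arguments eR {R d} j.

(* Main.v *)
Require Import Defs.
From mathcomp Require Import all_boot all_order all_algebra.
From mathcomp Require Import all_classical all_reals all_analysis.
From mathcomp Require Import complex ring lra zify.
Set Implicit Arguments. Unset Strict Implicit. Unset Printing Implicit Defensive.
Import Order.TTheory GRing.Theory Num.Theory.
Import numFieldNormedType.Exports.
Local Open Scope classical_set_scope.
Local Open Scope ring_scope.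

(** Let B be the set of lattice points X with |X - nc|_Sigma <= n delta'/3.  The
lower bounds on n make every jump, and every lattice vector u with |u| <= |J|,
shorter than n delta/320 in the Sigma-norm, so on B the restriction to the
delta-ball is invisible and all differences of h are taken in the ball of radius
n delta/4.  Newton's expansion
  h(X+J) - h(X) = J.Dh + 1/2 (J^T D2h J - sum_j J_j D_jj h) + remainder
and Taylor's expansion of g^J at c then split A_n^delta h - tilde A_n h into
three parts; F(c) = 0 removes the constant drift and the diagonal correction.
The first two parts are bounded pointwise and integrated with the second moment
of W.  The remainder is a signed sum of differences D_jk h(X+u) - D_jk h(X),
whose mean over B is controlled by total variation: shifting p 1_B in l1-norm
costs at most 2 |u|_1 eps + 2 P(B^c).  Counting them by induction along unit
steps gives |J|_1^3 - sum_j J_j, and F(c) = 0 is used again to discard the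
linear term. *)

(** * Euclidean geometry and Rayleigh quotients *)

(** The rates in the second-order part are frozen at [c] on purpose. A difference
    [D2 h j k (X + u) - D2 h j k X] has only the pointwise bound [2 * M], with [M] a bound on
    [D2 h]; it becomes small only once the translation is moved from [h] to the law of W, and this
    requires weights [g J c] that do not depend on X. The fluctuation of the rate around [g J c] is
    paired with the first-order remainder instead: a crude bound on that remainder suffices, because
    the fluctuation has mean size of order [n^(-1/2)]. Unit-step paths are controlled in the
    Euclidean norm, which does not decrease along outward steps, while the ball lives in the
    Sigma-norm. The passage costs [sqrt (rho Sig)], and the entry [1 / (64 * L0 * rho s2 * rho Sig)]
    of [th1] pays for it. In the tail term, Chebyshev's inequality at radius [n delta' / 3] produces
    9 and the two tails of the shift estimate double it, so 18 stands where 32 is allowed. *)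

Section EuclideanNorm.
Variables (R : realType) (d : nat).
Implicit Types (x y : 'cV[R]_d) (M : 'M[R]_d).

Lemma enorm_ge0 x : 0 <= enorm x.
Proof. exact: sqrtr_ge0. Qed.

Lemma sum_sqr_ge0 x : 0 <= \sum_i x i 0 ^+ 2.
Proof. by apply: sumr_ge0 => i _; exact: sqr_ge0. Qed.

Lemma enorm_sqr x : enorm x ^+ 2 = \sum_i x i 0 ^+ 2.
Proof. by rewrite sqr_sqrtr// sum_sqr_ge0. Qed.

Lemma enorm_sqr_mx x : enorm x ^+ 2 = (x^T *m x) 0 0.
Proof.
by rewrite enorm_sqr mxE; apply: eq_bigr => i _; rewrite mxE expr2.
Qed.

Lemma enorm0_eq0 x : enorm x = 0 -> x = 0.
Proof.
move=> x0; have /eqP := enorm_sqr x; rewrite x0 expr0n/= eq_sym.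
rewrite psumr_eq0 => [/allP h|i _]; last exact: sqr_ge0.
apply/colP => i; rewrite mxE; apply/eqP; rewrite -sqrf_eq0.
by apply: h; rewrite mem_index_enum.
Qed.

Lemma enorm_0 : enorm (0 : 'cV[R]_d) = 0.
Proof.
by rewrite /enorm big1 ?sqrtr0// => i _; rewrite mxE expr0n.
Qed.

Lemma enorm_gt0 x : x != 0 -> 0 < enorm x.
Proof.
by move=> x0; rewrite lt_def enorm_ge0 andbT; apply: contra x0 => /eqP/enorm0_eq0 ->.
Qed.

Lemma enormZ a x : enorm (a *: x) = `|a| * enorm x.
Proof.
rewrite /enorm -sqrtr_sqr -sqrtrM ?sqr_ge0// mulr_sumr.
by congr Num.sqrt; apply: eq_bigr => i _; rewrite mxE exprMn.
Qed.

Lemma enormN x : enorm (- x) = enorm x.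
Proof. by rewrite -scaleN1r enormZ normrN normr1 mul1r. Qed.

Lemma cauchy_schwarz x y : \sum_i x i 0 * y i 0 <= enorm x * enorm y.
Proof.
have [x0|/enorm_gt0 x0] := eqVneq x 0.
  by rewrite x0 big1 => [|i _]; rewrite ?enorm_0 ?mul0r// mxE mul0r.
have [y0|/enorm_gt0 y0] := eqVneq y 0.
  by rewrite y0 big1 => [|i _]; rewrite ?enorm_0 ?mulr0// mxE mulr0.
have : 0 <= \sum_i (enorm y * x i 0 - enorm x * y i 0) ^+ 2.
  by apply: sumr_ge0 => i _; exact: sqr_ge0.
have -> : \sum_i (enorm y * x i 0 - enorm x * y i 0) ^+ 2 =
    enorm y ^+ 2 * \sum_i x i 0 ^+ 2 + enorm x ^+ 2 * \sum_i y i 0 ^+ 2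
      - 2 * enorm x * enorm y * \sum_i x i 0 * y i 0.
  by rewrite !mulr_sumr -big_split/= -sumrB; apply: eq_bigr => i _; ring.
rewrite -!enorm_sqr => h.
have xy0 : 0 < enorm x * enorm y by exact: mulr_gt0.
by rewrite -(ler_pM2l xy0); lra.
Qed.

Lemma cauchy_schwarz_norm x y :
  \sum_i `|x i 0| * `|y i 0| <= enorm x * enorm y.
Proof.
have abs (z : 'cV[R]_d) : enorm z = enorm (\col_i `|z i 0|).
  by rewrite /enorm; congr Num.sqrt; apply: eq_bigr => i _; rewrite mxE real_normK// num_real.
rewrite (abs x) (abs y); apply: le_trans (cauchy_schwarz _ _).
by apply: ler_sum => i _; rewrite !mxE.
Qed.

Lemma ler_enormD x y : enorm (x + y) <= enorm x + enorm y.
Proof.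
rewrite -(ler_pXn2r (_ : (0 < 2)%N))// ?nnegrE ?addr_ge0 ?enorm_ge0//.
rewrite sqrrD !enorm_sqr mulr2n.
have cs := cauchy_schwarz x y.
have -> : \sum_i (x + y) i 0 ^+ 2 =
    \sum_i x i 0 ^+ 2 + \sum_i y i 0 ^+ 2 + 2 * \sum_i x i 0 * y i 0.
  by rewrite mulr_sumr -!big_split/=; apply: eq_bigr => i _; rewrite mxE; ring.
by lra.
Qed.

Lemma coord_le_enorm x i : `|x i 0| <= enorm x.
Proof.
rewrite -sqrtr_sqr ler_sqrt ?sum_sqr_ge0// (bigD1 i)//= lerDl.
by apply: sumr_ge0 => j _; exact: sqr_ge0.
Qed.

Lemma enorm_le_sum x : enorm x <= \sum_i `|x i 0|.
Proof.
have s0 : 0 <= \sum_i `|x i 0| by exact: sumr_ge0.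
rewrite -(ler_pXn2r (_ : (0 < 2)%N))// ?nnegrE ?enorm_ge0//.
rewrite enorm_sqr expr2 mulr_suml; apply: ler_sum => i _.
rewrite -real_normK ?num_real// expr2 ler_wpM2l// (bigD1 i)//= lerDl.
exact: sumr_ge0.
Qed.

Lemma enorm_delta (j : 'I_d) : enorm (@eR R d j) = 1.
Proof.
rewrite /enorm (bigD1 j)//= big1 ?addr0 => [|i ij].
  by rewrite !mxE !eqxx expr1n sqrtr1.
by rewrite mxE (negbTE ij) expr0n.
Qed.

Lemma quad_formE M x : (x^T *m M *m x) 0 0 = \sum_i \sum_j x i 0 * M i j * x j 0.
Proof.
rewrite mxE exchange_big/=; apply: eq_bigr => j _; rewrite mxE mulr_suml.
by apply: eq_bigr => i _; rewrite mxE.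
Qed.

Lemma quad_form_le M x : (x^T *m M *m x) 0 0 <= enorm x * enorm (M *m x).
Proof.
apply: le_trans (cauchy_schwarz _ _).
by rewrite -mulmxA mxE; apply: ler_sum => i _; rewrite !mxE.
Qed.

End EuclideanNorm.

(** * Compactness of Euclidean balls and spheres *)

Section Compactness.
Variables (R : realType) (d : nat).
Implicit Types (x y c : 'cV[R]_d) (M : 'M[R]_d).

Lemma trmx_continuous m n : continuous (fun M : 'M[R]_(m, n) => M^T).
Proof.
move=> M s /nbhs_ballP[e e0 es]; apply/nbhs_ballP; exists e => //= N [_ MN].
by apply: es; split => // i j; rewrite !mxE; exact: MN.
Qed.

Lemma quad_form_continuous M : continuous (fun x => (x^T *m M *m x) 0 0).
Proof.
have -> : (fun x => (x^T *m M *m x) 0 0) =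
    (fun x => \sum_i \sum_j x i 0 * M i j * x j 0).
  by apply/funext => x; rewrite quad_formE.
apply: continuous_big => [|i _]; first exact: add_continuous.
apply: continuous_big => [|j _ x]; first exact: add_continuous.
have ci k : (fun y : 'cV[R]_d => y k 0) @ x --> x k 0 by exact: coord_continuous.
exact: cvgM (cvgM (ci i) (cvg_cst _)) (ci j).
Qed.

Lemma enorm_continuous : continuous (@enorm R d).
Proof.
move=> x; have -> : @enorm R d = fun x => Num.sqrt ((x^T *m 1%:M *m x) 0 0).
  by apply/funext => y; rewrite mulmx1 -enorm_sqr_mx sqrtr_sqr ger0_norm ?enorm_ge0.
apply: (@continuous_comp _ _ _ (fun y : 'cV[R]_d => (y^T *m 1%:M *m y) 0 0)).
  exact: quad_form_continuous.
exact: sqrt_continuous.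
Qed.

(** Coordinates are bounded by the norm, so the set is a closed subset of the transpose of a compact
    cube of row vectors. *)
Lemma enorm_bounded_preimage_closedact (A : set 'cV[R]_d) r :
  (forall x, A x -> enorm x <= r) -> closed A -> compact A.
Proof.
move=> Ar Acl.
have cB : compact ((fun M : 'rV[R]_d => M^T) @`
    [set v : 'rV[R]_d | forall i, v ord0 i \in `[- r, r]]).
  apply: continuous_compact; first exact/continuous_subspaceT/trmx_continuous.
  apply: (@rV_compact _ _ (fun=> `[- r, r]%classic)) => _.
  exact: segment_compact.
apply: subclosed_compact Acl cB _ => x Ax; exists x^T; last exact: trmxK.
move=> i; rewrite mxE in_itv/= -ler_norml.
exact: le_trans (coord_le_enorm _ _) (Ar _ Ax).
Qed.

Lemma cball_compact c r : compact (cball c r).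
Proof.
apply: (@enorm_bounded_preimage_closedact _ (r + enorm c)) => [x|].
  rewrite /cball/= => xr; rewrite -[x](subrK c).
  by rewrite (le_trans (ler_enormD _ _))// lerD2r.
have -> : cball c r = (fun x => enorm (x - c)) @^-1` [set t | t <= r] by [].
apply: preimage_closed; last exact: closed_le.
move=> x _; apply: (@continuous_comp _ _ _ (fun y : 'cV[R]_d => y - c)).
  have cx : (fun y : 'cV[R]_d => y) @ x --> x by exact: cvg_id.
  exact: cvgB cx (cvg_cst _).
exact: enorm_continuous.
Qed.

Lemma sphere_compact : compact [set x : 'cV[R]_d | enorm x = 1].
Proof.
apply: (@enorm_bounded_preimage_closedact _ 1) => [x ->//|].
have -> : [set x : 'cV[R]_d | enorm x = 1] = (@enorm R d) @^-1` [set 1] by [].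
by apply: preimage_closed => [x _|]; [exact: enorm_continuous|exact: closed_eq].
Qed.

Lemma cball_center c r : 0 < r -> cball c r c.
Proof. by move=> r0; rewrite /cball/= subrr enorm_0 ltW. Qed.

Lemma continuous_cball_bounded c r (f : 'cV[R]_d -> R) : 0 < r ->
  (forall x, cball c r x -> {for x, continuous f}) ->
  exists K, forall x, cball c r x -> f x <= K.
Proof.
move=> r0 cf.
have [||y _ hy] := @compact_EVT_max _ R f _ _ (@cball_compact c r).
- by exists c; exact: cball_center.
- by apply: continuous_in_subspaceT => x; rewrite inE => /cf.
- by exists (f y) => x Bx; apply: hy; rewrite inE.
Qed.

End Compactness.

Section Rayleigh.
Variables (R : realType) (d : nat).
Implicit Types (x y : 'cV[R]_d) (M : 'M[R]_d).

Lemma dot_sym M x y : symmx M -> (x^T *m M *m y) 0 0 = (y^T *m M *m x) 0 0.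
Proof.
move=> sM; have -> : y^T *m M *m x = (x^T *m M *m y)^T.
  by rewrite !trmx_mul trmxK sM mulmxA.
by rewrite [RHS]mxE.
Qed.

Lemma quad_formD M x y (t : R) : symmx M ->
  ((x + t *: y)^T *m M *m (x + t *: y)) 0 0 =
  (x^T *m M *m x) 0 0 + 2 * t * (y^T *m M *m x) 0 0
    + t ^+ 2 * (y^T *m M *m y) 0 0.
Proof.
move=> sM; have e : (x + t *: y)^T = x^T + t *: y^T.
  by apply/matrixP => i j; rewrite !mxE.
have h := dot_sym x y sM; rewrite e !mulmxDl !mulmxDr -!scalemxAl -!scalemxAr.
have E (a b : 'M[R]_1) : (a + b) 0 0 = a 0 0 + b 0 0 by rewrite mxE.
have Z s (a : 'M[R]_1) : (s *: a) 0 0 = s * a 0 0 by rewrite mxE.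
by rewrite !(E, Z) h; ring.
Qed.

Lemma quad_formZ M x (t : R) :
  ((t *: x)^T *m M *m (t *: x)) 0 0 = t ^+ 2 * (x^T *m M *m x) 0 0.
Proof.
rewrite !quad_formE mulr_sumr; apply: eq_bigr => i _; rewrite mulr_sumr.
by apply: eq_bigr => j _; rewrite !mxE; ring.
Qed.

Lemma quad_form_scalarB M a x :
  (x^T *m (a%:M - M) *m x) 0 0 = a * enorm x ^+ 2 - (x^T *m M *m x) 0 0.
Proof.
rewrite mulmxBr mulmxBl mul_mx_scalar -scalemxAl enorm_sqr_mx.
by rewrite [LHS]mxE [X in X + _]mxE [X in _ + X]mxE.
Qed.

(** If [z = M x] were nonzero, a step from x against z would make the form negative. Dividing by
    [q + 1] rather than [q] keeps the step meaningful when [q = 0]. *)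
Lemma psd_quad_eq0 M x : symmx M ->
  (forall y, 0 <= (y^T *m M *m y) 0 0) -> (x^T *m M *m x) 0 0 = 0 ->
  M *m x = 0.
Proof.
move=> sM psd x0; set z := M *m x.
have zz : (z^T *m M *m x) 0 0 = enorm z ^+ 2 by rewrite -mulmxA enorm_sqr_mx.
have [->//|/enorm_gt0 z0] := eqVneq z 0.
have z2 : 0 < enorm z ^+ 2 by rewrite exprn_gt0.
have q0 := psd z; set q := (z^T *m M *m z) 0 0 in q0.
pose t := - (enorm z ^+ 2 / (q + 1)).
have q1 : 0 < q + 1 by lra.
have := psd (x + t *: z); rewrite quad_formD// x0 zz -/q => h.
have e : enorm z ^+ 2 = - t * (q + 1) by rewrite /t opprK mulfVK// gt_eqF.
have t0 : t < 0 by rewrite /t oppr_lt0 divr_gt0.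
rewrite e in h; exfalso.
have : 0 < t ^+ 2 by rewrite exprn_even_gt0//= lt_eqF.
have : 0 <= t ^+ 2 * q by rewrite mulr_ge0// sqr_ge0.
nra.
Qed.

Lemma symmx_eigen_col M x a : symmx M -> x != 0 -> M *m x = a *: x ->
  eigenvalue M a.
Proof.
move=> sM x0 Mx; apply/eigenvalueP; exists x^T.
  by rewrite -[M in LHS]sM -trmx_mul Mx linearZ.
by apply: contra x0 => /eqP e; rewrite -[x]trmxK e trmx0.
Qed.

Lemma eigenvalue_le M (a b : R) :
  (forall x, (x^T *m M *m x) 0 0 <= b * enorm x ^+ 2) ->
  eigenvalue M a -> a <= b.
Proof.
move=> Mb /eigenvalueP[v vM v0].
have w0 : v^T != 0 by apply: contra v0 => /eqP e; rewrite -[v]trmxK e trmx0.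
have := Mb v^T; rewrite trmxK vM -scalemxAl mxE.
have -> : (v *m v^T) 0 0 = enorm v^T ^+ 2 by rewrite enorm_sqr_mx trmxK.
by rewrite ler_pM2r// exprn_gt0// enorm_gt0.
Qed.

(** Let y maximise the form on the unit sphere, with value a. Then [a%:M - M] is positive
    semidefinite and its form vanishes at y, so y is an eigenvector. Hence [lam_max] is a genuine
    maximum and not the default value of [sup]. *)
Lemma lam_max_rayleigh M : (0 < d)%N -> symmx M ->
  eigenvalue M (lam_max M) /\
  forall x, (x^T *m M *m x) 0 0 <= lam_max M * enorm x ^+ 2.
Proof.
move=> d0 sM.
have [||y] := @compact_EVT_max _ R (fun x => (x^T *m M *m x) 0 0) _ _
    (@sphere_compact R d).
- by exists (eR (Ordinal d0)); exact: enorm_delta.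
- exact/continuous_subspaceT/quad_form_continuous.
rewrite inE/= => y1 ymax; set a := (y^T *m M *m y) 0 0 in ymax.
have y0 : y != 0.
  by apply: contra_eq_neq y1 => ->; rewrite enorm_0 eq_sym oner_neq0.
have ub x : (x^T *m M *m x) 0 0 <= a * enorm x ^+ 2.
  have [->|/enorm_gt0 x0] := eqVneq x 0.
    by rewrite mulmx0 mxE enorm_0 expr0n mulr0.
  have := ymax ((enorm x)^-1 *: x).
  rewrite inE/= enormZ gtr0_norm ?invr_gt0// mulVf ?gt_eqF// => /(_ erefl).
  by rewrite quad_formZ exprVn mulrC ler_pdivrMr// exprn_gt0.
have ea : eigenvalue M a.
  apply: (symmx_eigen_col sM y0); apply/eqP; rewrite -subr_eq0 -oppr_eq0 opprB.
  rewrite -mul_scalar_mx -mulmxBl; apply/eqP/psd_quad_eq0.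
  - by rewrite /symmx linearB/= tr_scalar_mx sM.
  - by move=> z; rewrite quad_form_scalarB subr_ge0.
  - by rewrite quad_form_scalarB y1 expr1n mulr1 subrr.
have -> : lam_max M = a.
  apply/eqP; rewrite eq_le; apply/andP; split.
    by apply: ge_sup => [|b /= /eigenvalue_le]; [exists a|exact].
  by apply: ub_le_sup => //; exists a => b /= /eigenvalue_le; exact.
by split.
Qed.

Lemma eigenvalueN M a : eigenvalue (- M) (- a) = eigenvalue M a.
Proof.
apply/eigenvalueP/eigenvalueP => -[v vM v0]; exists v => //.
  by apply: oppr_inj; rewrite -mulmxN vM scaleNr.
by rewrite mulmxN vM scaleNr.
Qed.

Lemma lam_minE M : lam_min M = - lam_max (- M).
Proof.
rewrite /lam_min /lam_max /inf; congr (- sup _).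
apply/seteqP; split => [_ [b /= eb <-]|a /= ea]; first by rewrite eigenvalueN.
by exists (- a); rewrite ?opprK//= -eigenvalueN opprK.
Qed.

Lemma lam_min_rayleigh M : (0 < d)%N -> symmx M ->
  eigenvalue M (lam_min M) /\
  forall x, lam_min M * enorm x ^+ 2 <= (x^T *m M *m x) 0 0.
Proof.
move=> d0 sM; have sN : symmx (- M) by rewrite /symmx linearN/= sM.
have [eM hM] := lam_max_rayleigh d0 sN; rewrite lam_minE; split.
  by rewrite -eigenvalueN opprK.
move=> x; have := hM x; rewrite mulmxN mulNmx mxE mulNr; lra.
Qed.

Lemma posdef_eigenvalue_gt0 M a : posdef M -> eigenvalue M a -> 0 < a.
Proof.
move=> pM /eigenvalueP[v vM v0].
have w0 : v^T != 0 by apply: contra v0 => /eqP e; rewrite -[v]trmxK e trmx0.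
have := pM _ w0; rewrite trmxK vM -scalemxAl mxE.
have -> : (v *m v^T) 0 0 = enorm v^T ^+ 2 by rewrite enorm_sqr_mx trmxK.
by rewrite pmulr_lgt0// exprn_gt0// enorm_gt0.
Qed.

Lemma posdef_lam_min_gt0 M : (0 < d)%N -> symmx M -> posdef M -> 0 < lam_min M.
Proof.
by move=> d0 sM pM; apply: (posdef_eigenvalue_gt0 pM); have [] := lam_min_rayleigh d0 sM.
Qed.

Lemma lam_min_le_max M : (0 < d)%N -> symmx M -> lam_min M <= lam_max M.
Proof.
move=> d0 sM; have [e _] := lam_min_rayleigh d0 sM.
by have [_ /eigenvalue_le h] := lam_max_rayleigh d0 sM; exact: h.
Qed.

Lemma posdef_unitmx M : posdef M -> M \in unitmx.
Proof.
move=> pM; rewrite -row_free_unit -kermx_eq0; apply/rowV0P => v /sub_kermxP vM.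
apply/eqP/negPn/negP => v0.
have w0 : v^T != 0 by apply: contra v0 => /eqP e; rewrite -[v]trmxK e trmx0.
by have := pM _ w0; rewrite trmxK vM mul0mx mxE ltxx.
Qed.

Lemma posdef_rho_ge1 M : (0 < d)%N -> symmx M -> posdef M -> 1 <= rho M.
Proof.
move=> d0 sM pM; rewrite /rho ler_pdivlMr ?mul1r ?posdef_lam_min_gt0//.
exact: lam_min_le_max.
Qed.

End Rayleigh.

(** * Taylor bounds for the rates *)

Section OperatorNorm.
Variables (R : realType) (d : nat).
Implicit Types (x : 'cV[R]_d) (M : 'M[R]_d).

Lemma enorm_mulmx_le M x : enorm x = 1 ->
  enorm (M *m x) <= \sum_i \sum_j `|M i j|.
Proof.
move=> x1; apply: le_trans (enorm_le_sum _) _; apply: ler_sum => i _.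
rewrite mxE; apply: le_trans (ler_norm_sum _ _ _) _; apply: ler_sum => j _.
by rewrite normrM ler_piMr// -x1 coord_le_enorm.
Qed.

(** The entrywise sum bounds the set behind [opnorm], so that its [sup] is a true upper bound and
    not the default value 0. *)
Lemma enorm_mulmx_opnorm M x : enorm (M *m x) <= opnorm M * enorm x.
Proof.
have [->|x0] := eqVneq x 0; first by rewrite mulmx0 enorm_0 mulr0.
have x1 : enorm ((enorm x)^-1 *: x) = 1.
  by rewrite enormZ gtr0_norm ?invr_gt0 ?enorm_gt0// mulVf// gt_eqF ?enorm_gt0.
rewrite -ler_pdivrMr ?enorm_gt0//; apply: ub_le_sup.
  by exists (\sum_i \sum_j `|M i j|) => _ [y /= y1 <-]; exact: enorm_mulmx_le.
exists ((enorm x)^-1 *: x) => //=.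
by rewrite -scalemxAr enormZ gtr0_norm ?invr_gt0 ?enorm_gt0// mulrC.
Qed.

Lemma opnorm_le_sum M : (0 < d)%N -> opnorm M <= \sum_i \sum_j `|M i j|.
Proof.
move=> d0; apply: ge_sup => [|_ [y /= y1 <-]]; last exact: enorm_mulmx_le.
exists (enorm (M *m eR (Ordinal d0))); exists (eR (Ordinal d0)) => //.
exact: enorm_delta.
Qed.

End OperatorNorm.

Section SecondOrderTaylor.
Variable R : realType.
Implicit Types phi dphi : R -> R.

Lemma is_derive_within_continuous phi dphi (a b : R) :
  (forall t : R, t \in `[a, b]%R -> is_derive t 1 phi (dphi t)) ->
  {within `[a, b], continuous phi}.
Proof.
move=> h; apply: derivable_within_continuous => t tab.
by have [] := h t tab.
Qed.

Lemma is_derive_MVT phi dphi (a b : R) : a <= b ->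
  (forall t : R, t \in `[a, b]%R -> is_derive t 1 phi (dphi t)) ->
  exists2 t, t \in `[a, b]%R & phi b - phi a = dphi t * (b - a).
Proof.
move=> ab h; have cphi := is_derive_within_continuous h.
have ho (t : R) : t \in `]a, b[%R -> is_derive t 1 phi (dphi t).
  by move=> tab; exact: h t (subset_itv_oo_cc tab).
exact: (@MVT_segment R phi dphi a b ab ho cphi).
Qed.

Lemma taylor2_upper phi phi1 (K : R) :
  (forall t : R, t \in `[0, 1]%R -> is_derive t 1 phi (phi1 t)) ->
  (forall t : R, t \in `[0, 1]%R -> phi1 t - phi1 0 <= K * t) ->
  phi 1 - phi 0 - phi1 0 <= K / 2.
Proof.
move=> dphi hK.
(* Subtracting the quadratic majorant leaves a function with nonpositive derivative, so a single use
   of the mean value theorem yields the factor 1/2. *)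
pose psi (t : R) := phi t - (phi1 0 * t + K / 2 * t ^+ 2).
have dpsi (t : R) : t \in `[0, 1]%R -> is_derive t 1 psi (phi1 t - (phi1 0 + K * t)).
  move=> /dphi dt; rewrite /psi; apply: is_derive_eq.
  by rewrite /GRing.scale/=; lra.
have [t t01] := is_derive_MVT ler01 dpsi.
have := hK t t01; rewrite /psi; lra.
Qed.

Lemma taylor2 phi phi1 phi2 (K : R) :
  (forall t : R, t \in `[0, 1]%R -> is_derive t 1 phi (phi1 t)) ->
  (forall t : R, t \in `[0, 1]%R -> is_derive t 1 phi1 (phi2 t)) ->
  (forall t : R, t \in `[0, 1]%R -> `|phi2 t| <= K) ->
  `|phi 1 - phi 0 - phi1 0| <= K / 2.
Proof.
move=> d1 d2 hK.
have step (t : R) : t \in `[0, 1]%R -> `|phi1 t - phi1 0| <= K * t.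
  rewrite in_itv/= => /andP[t0 t1].
  have [s|s s0t ->] := @is_derive_MVT phi1 phi2 0 t t0.
    by rewrite in_itv/= => /andP[s0 st]; apply: d2; rewrite in_itv/= s0 (le_trans st).
  rewrite subr0 normrM (ger0_norm t0) ler_wpM2r// hK//.
  by move: s0t; rewrite !in_itv/= => /andP[-> st]; rewrite (le_trans st).
rewrite ler_norml; apply/andP; split; last first.
  by apply: taylor2_upper d1 _ => t /step; rewrite ler_norml => /andP[].
have d1N (t : R) : t \in `[0, 1]%R -> is_derive t 1 (- phi) (- phi1 t).
  by move=> /d1 h; exact: is_deriveN.
suff : (- phi) 1 - (- phi) 0 - - phi1 0 <= K / 2 by rewrite !opprfctE; lra.
apply: (@taylor2_upper (- phi) (fun t => - phi1 t)) d1N _ => t /step.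
by rewrite ler_norml => /andP[]; lra.
Qed.

End SecondOrderTaylor.

Section GradientBounds.
Variables (R : realType) (d : nat).
Implicit Types (f : 'cV[R]_d -> R) (x v c : 'cV[R]_d).

Lemma diff_partialE f x v : differentiable f x ->
  'd f x v = \sum_i v i 0 * partial f i x.
Proof.
move=> df; have e : v = \sum_i v i 0 *: eR i.
  apply/colP => k; rewrite summxE (bigD1 k)//= big1 => [|i ik].
    by rewrite !mxE !eqxx mulr1 addr0.
  by rewrite !mxE eq_sym (negbTE ik) mulr0.
rewrite [in LHS]e linear_sum; apply: eq_bigr => i _.
by rewrite linearZ/= /partial deriveE.
Qed.

Lemma is_derive_line f c v (t : R) : differentiable f (c + t *: v) ->
  is_derive t 1 (fun s : R => f (c + s *: v))
    (\sum_i v i 0 * partial f i (c + t *: v)).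
Proof.
move=> df; pose l (s : R) := c + s *: v.
have dl : is_diff t l ( *:%R ^~ v).
  have -> : l = cst c + ( *:%R ^~ v) by apply/funext => s.
  have hc : is_diff t (cst c : R -> 'cV[R]_d) 0 by exact: is_diff_cst.
  have hs : is_diff t ( *:%R ^~ v : R -> 'cV[R]_d) ( *:%R ^~ v).
    exact: is_diff_scalel.
  by rewrite -[X in is_diff _ _ X]add0r; exact: is_diffD hc hs.
have dfl : is_diff t (f \o l) ('d f (l t) \o ( *:%R ^~ v)).
  have df' : is_diff (l t) f ('d f (l t)) by exact: differentiableP.
  exact: is_diff_comp dl df'.
apply: DeriveDef; first exact/derivable1_diffP.
rewrite deriveE// -[fun s => _]/(f \o l) diff_val/= scale1r.
exact: diff_partialE.
Qed.

Lemma cball_segment c r x (t : R) : cball c r x -> t \in `[0, 1]%R ->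
  cball c r (c + t *: (x - c)).
Proof.
rewrite /cball/= in_itv/= => xr /andP[t0 t1]; rewrite (addrC c) addrK enormZ.
by rewrite ger0_norm// (le_trans _ xr)// ler_piMl// enorm_ge0.
Qed.

Lemma gradient_bound f c r K x :
  (forall y, cball c r y -> differentiable f y) ->
  (forall y, cball c r y -> enorm (grad f y) <= K) -> cball c r x ->
  `|f x - f c| <= K * enorm (x - c).
Proof.
move=> df hK xr.
have dl (t : R) : t \in `[0, 1]%R -> is_derive t 1 (fun s : R => f (c + s *: (x - c)))
    (\sum_i (x - c) i 0 * partial f i (c + t *: (x - c))).
  by move=> /(cball_segment xr) /df; exact: is_derive_line.
have [t t01] := is_derive_MVT ler01 dl.
rewrite scale1r scale0r addr0 addrCA subrr addr0 subr0 mulr1 => ->.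
have ht := hK _ (cball_segment xr t01).
apply: le_trans (ler_norm_sum _ _ _) _.
rewrite mulrC; apply: le_trans (ler_wpM2l (enorm_ge0 _) ht).
apply: le_trans (cauchy_schwarz_norm _ _).
by apply: ler_sum => i _; rewrite normrM [grad _ _ _ _]mxE.
Qed.

Lemma hessian_bound f c r K x :
  (forall y, cball c r y -> differentiable f y) ->
  (forall y i, cball c r y -> differentiable (partial f i) y) ->
  (forall y, cball c r y -> opnorm (hess f y) <= K) -> cball c r x ->
  `|f x - f c - \sum_i (x - c) i 0 * partial f i c| <=
    K * enorm (x - c) ^+ 2 / 2.
Proof.
move=> df d2f hK xr; set v := x - c.
have seg (t : R) : t \in `[0, 1]%R -> cball c r (c + t *: v) by exact: cball_segment.
have d1 (t : R) : t \in `[0, 1]%R -> is_derive t 1 (fun s : R => f (c + s *: v))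
    (\sum_i v i 0 * partial f i (c + t *: v)).
  by move=> /seg /df; exact: is_derive_line.
have d2 (t : R) : t \in `[0, 1]%R -> is_derive t 1
    (fun s : R => \sum_i v i 0 * partial f i (c + s *: v))
    (\sum_i v i 0 * \sum_j v j 0 * partial (partial f i) j (c + t *: v)).
  move=> /seg st.
  have -> : (fun s : R => \sum_i v i 0 * partial f i (c + s *: v)) =
      \sum_i (v i 0 \*: (fun s : R => partial f i (c + s *: v))).
    by apply/funext => s; rewrite fct_sumE.
  apply: is_derive_sum => i.
  exact: (is_deriveZ (v i 0) (is_derive_line (d2f _ i st))).
have := taylor2 d1 d2.
rewrite scale1r scale0r addr0 (addrC c) subrK; apply => t /seg st.
(* The derivatives come out in the order opposite to [hess]. A quadratic form does not see the
   transposition, so exchanging the sums is enough. *)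
have -> : \sum_i v i 0 * (\sum_j v j 0 * partial (partial f i) j (c + t *: v)) =
    (v^T *m hess f (c + t *: v) *m v) 0 0.
  rewrite quad_formE exchange_big/=; apply: eq_bigr => i _; rewrite mulr_sumr.
  by apply: eq_bigr => j _; rewrite [hess _ _ _ _]mxE; ring.
have le M : `|(v^T *m M *m v) 0 0| <= enorm v * enorm (M *m v).
  rewrite ler_norml quad_form_le andbT lerNl.
  have := quad_form_le (- M) v; rewrite !mulNmx mulmxN mulNmx enormN.
  by rewrite [X in X <= _ -> _]mxE.
apply: le_trans (le _) _; rewrite expr2 mulrA mulrC ler_wpM2r ?enorm_ge0//.
apply: le_trans (enorm_mulmx_opnorm _ _) _.
by rewrite ler_wpM2r ?enorm_ge0// hK.
Qed.

(** Since [sup] of an unbounded set is 0, this bound and the next two are what makes the suprema in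
    [L0], [L1] and [L2] true upper bounds. They rest on compactness of the ball. *)
Lemma C2_on_rate_bounded f c r : 0 < r -> C2_on (cball c r) f ->
  has_ubound [set f x | x in cball c r].
Proof.
move=> r0 [U [_ [BU C2]]].
have [|K hK] := @continuous_cball_bounded _ _ c r f r0.
  by move=> x /BU /C2[] /differentiable_continuous.
by exists K => _ [x Bx <-]; exact: hK.
Qed.

Lemma C2_on_grad_bounded f c r : 0 < r -> C2_on (cball c r) f ->
  has_ubound [set enorm (grad f x) | x in cball c r].
Proof.
move=> r0 [U [_ [BU C2]]].
have bd i : exists K, forall x, cball c r x -> `|partial f i x| <= K.
  apply: continuous_cball_bounded => // x /BU /C2[_ /(_ i)].
  move=> /differentiable_continuous cx _.
  by apply: (continuous_comp cx); exact: norm_continuous.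
have [K hK] := choice bd.
exists (\sum_i K i) => _ [x Bx <-]; apply: le_trans (enorm_le_sum _) _.
by apply: ler_sum => i _; rewrite mxE hK.
Qed.

Lemma C2_on_hess_bounded f c r : (0 < d)%N -> 0 < r -> C2_on (cball c r) f ->
  has_ubound [set opnorm (hess f x) | x in cball c r].
Proof.
move=> d0 r0 [U [_ [BU C2]]].
have bd (ij : 'I_d * 'I_d) : exists K, forall x, cball c r x ->
    `|partial (partial f ij.2) ij.1 x| <= K.
  apply: continuous_cball_bounded => // x /BU /C2[_ _ /(_ ij.2 ij.1)] cx.
  by apply: (continuous_comp cx); exact: norm_continuous.
have [K hK] := choice bd.
exists (\sum_i \sum_j K (i, j)) => _ [x Bx <-].
apply: le_trans (opnorm_le_sum _ d0) _.
by apply: ler_sum => i _; apply: ler_sum => j _; rewrite mxE (hK (i, j)).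
Qed.

End GradientBounds.

(** * Discrete Taylor expansion on the lattice *)

Section LatticeSteps.
Variables (R : realType) (d : nat).
Implicit Types (u X : 'cV[int]_d) (k : 'I_d) (a : 'I_d -> R).

Definition l1norm u : R := \sum_i `|(u i 0)%:~R|.
Definition coord_sum u : R := \sum_i (u i 0)%:~R.

Lemma eZ_same k : eZ k k 0 = 1.
Proof. by rewrite mxE !eqxx. Qed.

Lemma eZ_other k i : i != k -> eZ k i 0 = 0.
Proof. by move=> ik; rewrite mxE (negbTE ik). Qed.

(** Induction on the l1-norm in which every step points away from the origin. Each step then raises
    [l1norm] by exactly 1 and does not decrease [enorm], so a hypothesis valid for
    [enorm (toR u) <= r] passes down to the predecessor. *)
Lemma lattice_ind (P : 'cV[int]_d -> Prop) : P 0 ->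
  (forall u k, 0 <= u k 0 -> P u -> P (u + eZ k)) ->
  (forall u k, u k 0 <= 0 -> P u -> P (u - eZ k)) -> forall u, P u.
Proof.
move=> P0 PD PB u; have [m] := ubnP (\sum_i absz (u i 0)%R)%N.
elim: m u => // m IH u um.
have [u0|] := eqVneq u 0; first by rewrite u0.
move=> /eqP u0; have [k uk] : exists k, u k 0 != 0.
  apply/existsP; apply: contra_notT u0 => /existsPn h; apply/colP => i.
  by rewrite mxE; apply/eqP/negPn/h.
have dec (w : 'cV[int]_d) : (absz (w k 0)%R < absz (u k 0)%R)%N ->
    (forall i, i != k -> w i 0 = u i 0) ->
    (\sum_i absz (w i 0)%R < m)%N.
  move=> wk wu; move: um; rewrite (bigD1 k)//= [X in (X < m)%N](bigD1 k)//=.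
  have -> : (\sum_(i | i != k) absz (w i 0)%R = \sum_(i | i != k) absz (u i 0)%R)%N.
    by apply: eq_bigr => i /wu ->.
  by set S := (\sum_(i | _) _)%N; lia.
have [uk0|uk0] := ltP 0 (u k 0).
  rewrite -[u](subrK (eZ k)); apply: PD.
    by rewrite mxE [X in _ + X]mxE eZ_same; move: (u k 0) uk0 => z; lia.
  apply: IH; apply: dec => [|i ik].
    by rewrite mxE [X in _ + X]mxE eZ_same; move: (u k 0) uk0 => z; lia.
  by rewrite mxE [X in _ + X]mxE eZ_other// oppr0 addr0.
rewrite -[u](addrK (eZ k)); apply: PB.
  by rewrite mxE eZ_same; move: (u k 0) uk uk0 => z; lia.
apply: IH; apply: dec => [|i ik]; first by rewrite mxE eZ_same; move: (u k 0) uk uk0 => z; lia.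
by rewrite mxE eZ_other// addr0.
Qed.

Lemma sum_stepD a u k : \sum_i ((u + eZ k) i 0)%:~R * a i =
  \sum_i (u i 0)%:~R * a i + a k.
Proof.
rewrite (bigD1 k)//= [in RHS](bigD1 k)//= mxE eZ_same intrD mulrDl mul1r.
rewrite (eq_bigr (fun i => (u i 0)%:~R * a i)) => [|i ik]; first by ring.
by rewrite mxE eZ_other// addr0.
Qed.

Lemma coord_sumD u k : coord_sum (u + eZ k) = coord_sum u + 1.
Proof.
have := sum_stepD (fun=> 1) u k; rewrite /coord_sum.
by under eq_bigr do rewrite mulr1; under [in RHS]eq_bigr do rewrite mulr1.
Qed.

Lemma l1normD u k : 0 <= u k 0 -> l1norm (u + eZ k) = l1norm u + 1.
Proof.
move=> uk; rewrite /l1norm (bigD1 k)//= [in RHS](bigD1 k)//= mxE eZ_same.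
rewrite (eq_bigr (fun i => `|(u i 0)%:~R|)) => [|i ik]; last first.
  by rewrite mxE eZ_other// addr0.
rewrite intrD ger0_norm ?ger0_norm ?ler0z// ?addr_ge0 ?ler0z//; ring.
Qed.

Lemma toRD u X : toR (u + X) = toR u + toR X :> 'cV[R]_d.
Proof. by apply/colP => i; rewrite !mxE intrD. Qed.

Lemma toRN u : toR (- u) = - toR u :> 'cV[R]_d.
Proof. by apply/colP => i; rewrite !mxE intrN. Qed.

Lemma l1normN u : l1norm (- u) = l1norm u.
Proof. by apply: eq_bigr => i _; rewrite mxE intrN normrN. Qed.

Lemma l1normB u k : u k 0 <= 0 -> l1norm (u - eZ k) = l1norm u + 1.
Proof.
by move=> uk; rewrite -l1normN opprB addrC l1normD ?l1normN// mxE oppr_ge0.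
Qed.

Lemma coord_sumB u k : coord_sum (u - eZ k) = coord_sum u - 1.
Proof. by rewrite -[in RHS](subrK (eZ k) u) coord_sumD addrK. Qed.

Lemma enorm_stepD u k : 0 <= u k 0 ->
  enorm (toR u : 'cV[R]_d) <= enorm (toR (u + eZ k) : 'cV[R]_d).
Proof.
move=> uk; rewrite ler_sqrt ?sum_sqr_ge0//; apply: ler_sum => i _.
rewrite mxE [leRHS](_ : _ = ((u + eZ k) i 0)%:~R ^+ 2); last by rewrite mxE.
rewrite mxE intrD; have [->|ik] := eqVneq i k; last by rewrite eZ_other// addr0.
have : 0 <= (u k 0)%:~R :> R by rewrite ler0z.
by rewrite eZ_same; nra.
Qed.

Lemma enorm_stepB u k : u k 0 <= 0 ->
  enorm (toR u : 'cV[R]_d) <= enorm (toR (u - eZ k) : 'cV[R]_d).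
Proof.
move=> uk; rewrite -enormN -[leRHS]enormN -!toRN opprB addrC enorm_stepD//.
by rewrite mxE oppr_ge0.
Qed.

Lemma l1norm_ge0 u : 0 <= l1norm u.
Proof. exact: sumr_ge0. Qed.

Lemma l1norm0 : l1norm 0 = 0.
Proof. by rewrite /l1norm big1// => i _; rewrite mxE normr0. Qed.

Lemma coord_sum0 : coord_sum 0 = 0.
Proof. by rewrite /coord_sum big1// => i _; rewrite mxE. Qed.

Lemma coord_sum_ge u : - l1norm u <= coord_sum u.
Proof.
rewrite -sumrN; apply: ler_sum => i _; rewrite lerNl -normrN; exact: ler_norm.
Qed.

(** Integers satisfy [|z| <= z ^ 2]. This saves a dimension factor: first differences along J are
    weighted by the squared length of J, which sums to the trace of [sigma2]. *)
Lemma l1norm_le_enorm_sqr u : l1norm u <= enorm (toR u : 'cV[R]_d) ^+ 2.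
Proof.
rewrite enorm_sqr; apply: ler_sum => i _; rewrite mxE -intr_norm -rmorphXn/=.
by rewrite ler_int; nia.
Qed.

Lemma l1norm_sqr_le u :
  l1norm u ^+ 2 <= d%:R * enorm (toR u : 'cV[R]_d) ^+ 2.
Proof.
have h : l1norm u <= Num.sqrt d%:R * enorm (toR u : 'cV[R]_d).
  have := cauchy_schwarz_norm (const_mx 1 : 'cV[R]_d) (toR u).
  rewrite {1}/enorm.
  have -> : \sum_i (const_mx 1 : 'cV[R]_d) i 0 ^+ 2 = d%:R.
    rewrite (eq_bigr (fun=> 1)) => [|i _]; last by rewrite mxE expr1n.
    by rewrite sumr_const card_ord.
  by apply: le_trans; apply: ler_sum => i _; rewrite !mxE normr1 mul1r.
rewrite -[X in X * _]sqr_sqrtr ?ler0n// -exprMn.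
by rewrite ler_pXn2r ?nnegrE ?l1norm_ge0 ?mulr_ge0 ?sqrtr_ge0.
Qed.

(** The diagonal correction cancels the term [a k k], so the increment is linear in u. It therefore
    matches the linear part of [D1 h k], and one step changes [taylor2_rem] by exactly [D1_rem]. *)
Lemma second_orderD (a : 'I_d -> 'I_d -> R) u k : (forall i j, a i j = a j i) ->
  let q w := \sum_i \sum_j (w i 0)%:~R * (w j 0)%:~R * a i j
             - \sum_i (w i 0)%:~R * a i i in
  q (u + eZ k) = q u + 2 * \sum_i (u i 0)%:~R * a i k.
Proof.
move=> sa q.
have E w : \sum_i \sum_j (w i 0)%:~R * (w j 0)%:~R * a i j =
    \sum_i (w i 0)%:~R * \sum_j (w j 0)%:~R * a i j.
  apply: eq_bigr => i _; rewrite mulr_sumr.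
  by apply: eq_bigr => j _; rewrite mulrA.
rewrite /q !E !sum_stepD.
have -> : \sum_i (u i 0)%:~R * (\sum_j ((u + eZ k) j 0)%:~R * a i j) =
    \sum_i (u i 0)%:~R * (\sum_j (u j 0)%:~R * a i j) + \sum_i (u i 0)%:~R * a i k.
  by rewrite -big_split/=; apply: eq_bigr => i _; rewrite sum_stepD mulrDr.
have -> : \sum_j (u j 0)%:~R * a k j = \sum_i (u i 0)%:~R * a i k.
  by apply: eq_bigr => i _; rewrite sa.
ring.
Qed.

End LatticeSteps.

Section DiscreteTaylor.
Variables (R : realType) (d : nat) (h : 'cV[int]_d -> R).
Implicit Types (u X : 'cV[int]_d).

Lemma D1E i X : D1 h i X = h (X + eZ i) - h X.
Proof. by []. Qed.

Lemma D2E i j X : D2 h i j X = D1 h j (X + eZ i) - D1 h j X.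
Proof. by []. Qed.

Lemma D2_sym i j X : D2 h i j X = D2 h j i X.
Proof. by rewrite /D2 /D1 [X + eZ i + eZ j]addrAC; ring. Qed.

Definition taylor1_rem u X :=
  h (X + u) - h X - \sum_i (u i 0)%:~R * D1 h i X.

(* The diagonal correction comes from the coefficient u_i (u_i - 1) / 2 of
   (1 + D_i)^{u_i}. *)
Definition taylor2_rem u X := taylor1_rem u X
  - 2^-1 * (\sum_i \sum_j (u i 0)%:~R * (u j 0)%:~R * D2 h i j X
            - \sum_i (u i 0)%:~R * D2 h i i X).

Definition D1_rem j u X :=
  D1 h j (X + u) - D1 h j X - \sum_i (u i 0)%:~R * D2 h i j X.

Lemma sum0_lattice (a : 'I_d -> R) : \sum_i ((0 : 'cV[int]_d) i 0)%:~R * a i = 0.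
Proof. by rewrite big1// => i _; rewrite mxE mul0r. Qed.

Lemma taylor1_rem0 X : taylor1_rem 0 X = 0.
Proof. by rewrite /taylor1_rem addr0 sum0_lattice; ring. Qed.

Lemma taylor1_remD u k X :
  taylor1_rem (u + eZ k) X = taylor1_rem u X + (D1 h k (X + u) - D1 h k X).
Proof. rewrite /taylor1_rem sum_stepD [X + (u + _)]addrA.
by rewrite (D1E k (X + u)); ring. Qed.

Lemma D1_rem0 j X : D1_rem j 0 X = 0.
Proof. by rewrite /D1_rem addr0 sum0_lattice; ring. Qed.

Lemma D1_remD j u k X :
  D1_rem j (u + eZ k) X = D1_rem j u X + (D2 h k j (X + u) - D2 h k j X).
Proof. rewrite /D1_rem sum_stepD [X + (u + _)]addrA.
by rewrite (D2E k j (X + u)); ring. Qed.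

Lemma taylor2_rem0 X : taylor2_rem 0 X = 0.
Proof.
rewrite /taylor2_rem taylor1_rem0 sum0_lattice big1 => [|i _]; first by ring.
by rewrite big1// => j _; rewrite !mxE !mul0r.
Qed.

Lemma taylor2_remD u k X :
  taylor2_rem (u + eZ k) X = taylor2_rem u X + D1_rem k u X.
Proof.
have e := second_orderD u k (fun i j => D2_sym i j X); rewrite /= in e.
rewrite /taylor2_rem e taylor1_remD /D1_rem; lra.
Qed.

Variables (r M : R).

(** Each unit step changes [D1] by at most M, hence the remainder by at most M times the l1-norm
    reached; [l ^ 2 + (l + 1) <= (l + 1) ^ 2] closes the induction. *)
Lemma taylor1_rem_bound X : 0 <= M ->
  (forall u i j, enorm (toR u : 'cV[R]_d) <= r -> `|D2 h i j (X + u)| <= M) ->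
  forall u, enorm (toR u : 'cV[R]_d) <= r ->
  `|taylor1_rem u X| <= M * l1norm R u ^+ 2.
Proof.
move=> M0 hM.
have D1b j u : enorm (toR u : 'cV[R]_d) <= r ->
    `|D1 h j (X + u) - D1 h j X| <= M * l1norm R u.
  elim/lattice_ind: u => [|u k uk IH|u k uk IH] ur.
  - by rewrite addr0 subrr normr0 l1norm0 mulr0.
  - have ur' := le_trans (enorm_stepD R uk) ur.
    have := hM u k j ur'; have := IH ur'; rewrite l1normD// addrA.
    rewrite (D2E k j (X + u)).
    rewrite !ler_norml => /andP[? ?] /andP[? ?].
    by apply/andP; split; lra.
  - have ur' := le_trans (enorm_stepB R uk) ur.
    have := hM _ k j ur; have := IH ur'; rewrite l1normB// addrA.
    rewrite (D2E k j (X + u - eZ k)).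
    rewrite subrK !ler_norml => /andP[? ?] /andP[? ?].
    by apply/andP; split; lra.
elim/lattice_ind => [|u k uk IH|u k uk IH] ur.
- by rewrite taylor1_rem0 normr0 l1norm0 expr0n mulr0.
- have ur' := le_trans (enorm_stepD R uk) ur; have l0 := l1norm_ge0 R u.
  have := D1b k u ur'; have := IH ur'; rewrite l1normD// taylor1_remD.
  move=> h1 h2; apply: le_trans (ler_normD _ _) _.
  by apply: le_trans (lerD h1 h2) _; nra.
- have ur' := le_trans (enorm_stepB R uk) ur; have l0 := l1norm_ge0 R u.
  have e : taylor1_rem (u - eZ k) X =
      taylor1_rem u X - (D1 h k (X + (u - eZ k)) - D1 h k X).
    by rewrite -[in RHS](subrK (eZ k) u) taylor1_remD subrK addrK.
  have := D1b k _ ur; have := IH ur'; rewrite l1normB// e.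
  move=> h1 h2; apply: le_trans (ler_normB _ _) _.
  by apply: le_trans (lerD h1 h2) _; nra.
Qed.

Variables (eps kap : R) (sB : seq 'cV[int]_d) (p : 'cV[int]_d -> R).
Hypotheses (M0 : 0 <= M) (eps0 : 0 <= eps) (kap0 : 0 <= kap).
Hypothesis shift_bound : forall u i j, enorm (toR u : 'cV[R]_d) <= r ->
  `|\sum_(X <- sB) p X * (D2 h i j (X + u) - D2 h i j X)| <=
  M * (2 * l1norm R u * eps + kap).

(** A step [+ eZ k] costs [2 * l1norm u * eps]. A step [- eZ k] is measured at its endpoint and
    costs [2 * (l1norm u + 1) * eps]. These are exactly the two increments of
    [l1norm u ^ 2 - coord_sum u]. *)
Lemma mean_D1_rem_bound j u : enorm (toR u : 'cV[R]_d) <= r ->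
  `|\sum_(X <- sB) p X * D1_rem j u X| <=
  M * (eps * (l1norm R u ^+ 2 - coord_sum R u) + kap * l1norm R u).
Proof.
elim/lattice_ind: u => [|u k uk IH|u k uk IH] ur.
- rewrite big1 => [|X _]; last by rewrite D1_rem0 mulr0.
  by rewrite normr0 l1norm0 coord_sum0 expr0n subr0 !mulr0 addr0 mulr0.
- have ur' := le_trans (enorm_stepD R uk) ur; have l0 := l1norm_ge0 R u.
  have -> : \sum_(X <- sB) p X * D1_rem j (u + eZ k) X =
      \sum_(X <- sB) p X * D1_rem j u X +
      \sum_(X <- sB) p X * (D2 h k j (X + u) - D2 h k j X).
    by rewrite -big_split/=; apply: eq_bigr => X _; rewrite D1_remD mulrDr.
  apply: le_trans (ler_normD _ _) _.
  apply: le_trans (lerD (IH ur') (shift_bound k j ur')) _.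
  by rewrite l1normD// coord_sumD -mulrDr ler_wpM2l//; lra.
- have ur' := le_trans (enorm_stepB R uk) ur; have l0 := l1norm_ge0 R u.
  have -> : \sum_(X <- sB) p X * D1_rem j (u - eZ k) X =
      \sum_(X <- sB) p X * D1_rem j u X -
      \sum_(X <- sB) p X * (D2 h k j (X + (u - eZ k)) - D2 h k j X).
    rewrite -sumrB; apply: eq_bigr => X _.
    by rewrite -[in RHS](subrK (eZ k) u) D1_remD subrK; ring.
  apply: le_trans (ler_normB _ _) _.
  apply: le_trans (lerD (IH ur') (shift_bound k j ur)) _.
  by rewrite l1normB// coord_sumB -mulrDr ler_wpM2l//; lra.
Qed.

(* The term - coord_sum u is exact for u = - e_k, where l1norm u ^+ 3 alone
   would be too small; it vanishes after averaging over jumps with zero drift. *)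
Lemma mean_taylor2_rem_bound u : enorm (toR u : 'cV[R]_d) <= r ->
  `|\sum_(X <- sB) p X * taylor2_rem u X| <=
  M * (eps * (l1norm R u ^+ 3 - coord_sum R u) + kap * l1norm R u ^+ 2).
Proof.
elim/lattice_ind: u => [|u k uk IH|u k uk IH] ur.
- rewrite big1 => [|X _]; last by rewrite taylor2_rem0 mulr0.
  by rewrite normr0 l1norm0 coord_sum0 !expr0n subr0 !mulr0 addr0 mulr0.
- have ur' := le_trans (enorm_stepD R uk) ur; have l0 := l1norm_ge0 R u.
  have cl := coord_sum_ge R u.
  have -> : \sum_(X <- sB) p X * taylor2_rem (u + eZ k) X =
      \sum_(X <- sB) p X * taylor2_rem u X + \sum_(X <- sB) p X * D1_rem k u X.
    by rewrite -big_split/=; apply: eq_bigr => X _; rewrite taylor2_remD mulrDr.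
  apply: le_trans (ler_normD _ _) _.
  apply: le_trans (lerD (IH ur') (mean_D1_rem_bound k ur')) _.
  rewrite l1normD// coord_sumD -mulrDr ler_wpM2l//.
  set l := l1norm R u in l0 cl *; set s := coord_sum R u in cl *.
  (* The slack between the increment of [l ^ 3 - s] and the bound [l ^ 2 - s] for [D1_rem]; it is
     nonnegative because [s >= - l]. *)
  have e1 : 0 <= eps * (2 * l ^+ 2 + 3 * l + s).
    by rewrite mulr_ge0//; nra.
  have e2 : 0 <= kap * (l + 1) by rewrite mulr_ge0//; lra.
  nra.
- have ur' := le_trans (enorm_stepB R uk) ur; have l0 := l1norm_ge0 R u.
  have cl := coord_sum_ge R u.
  have -> : \sum_(X <- sB) p X * taylor2_rem (u - eZ k) X =
      \sum_(X <- sB) p X * taylor2_rem u X -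
      \sum_(X <- sB) p X * D1_rem k (u - eZ k) X.
    rewrite -sumrB; apply: eq_bigr => X _.
    by rewrite -[in RHS](subrK (eZ k) u) taylor2_remD subrK; ring.
  apply: le_trans (ler_normB _ _) _.
  apply: le_trans (lerD (IH ur') (mean_D1_rem_bound k ur)) _.
  rewrite l1normB// coord_sumB -mulrDr ler_wpM2l//.
  set l := l1norm R u in l0 cl *; set s := coord_sum R u in cl *.
  have e1 : 0 <= eps * (2 * l ^+ 2 + l + s).
    by rewrite mulr_ge0//; nra.
  have e2 : 0 <= kap * l by rewrite mulr_ge0.
  nra.
Qed.

End DiscreteTaylor.

(** * Total variation *)

Section FiniteSums.
Variables (R : realType) (T : choiceType).
Implicit Types (s : seq T) (a : T -> R).

(** An [esum] is a supremum over finite sets. Through this bound the total mass and the second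
    moment enter only as estimates on duplicate-free lists. *)
Lemma esum_seq_le a (C : R) s : uniq s ->
  (\esum_(x in [set: T]) (a x)%:E <= C%:E)%E -> \sum_(x <- s) a x <= C.
Proof.
move=> us aC; rewrite -lee_fin -sumEFin fsbig_seq//.
by apply: le_trans aC; apply: esum_ge; exists [set` s] => //; split.
Qed.

Lemma esum_setE a s : uniq s -> (forall x, 0 <= a x) ->
  (\esum_(x in [set` s]) (a x)%:E = (\sum_(x <- s) a x)%:E)%E.
Proof.
move=> us a0; rewrite esum_fset => [|//|x _]; last by rewrite lee_fin.
by rewrite -fsbig_seq// sumEFin.
Qed.

Lemma sum_sub_seq a s s' : uniq s -> uniq s' -> {subset s <= s'} ->
  \sum_(x <- s) a x = \sum_(x <- s' | x \in s) a x.
Proof.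
move=> us us' ss'; rewrite -[RHS]big_filter; apply: perm_big; apply: uniq_perm => //.
  exact: filter_uniq.
by move=> x; rewrite mem_filter; case: (boolP (x \in s)) => // /ss' ->.
Qed.

End FiniteSums.

Section TotalVariation.
Variables (R : realType) (d : nat).
Implicit Types (p q f : 'cV[int]_d -> R) (s : seq 'cV[int]_d) (u : 'cV[int]_d).

Lemma dTV_seq p q (eps : R) s : (forall x, 0 <= p x) -> (forall x, 0 <= q x) ->
  (dTV p q <= eps%:E)%E -> uniq s -> `|\sum_(x <- s) (p x - q x)| <= eps.
Proof.
move=> p0 q0 pq us; rewrite -lee_fin; apply: le_trans pq.
apply: ereal_sup_ubound; exists [set` s] => //.
by rewrite /probp !esum_setE// -EFinB sumrB.
Qed.

(** [dTV] is a supremum over events, so the part where [p >= q] and the part where [p < q]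
    contribute at most [eps] each. *)
Lemma dTV_l1 p q (eps : R) s : (forall x, 0 <= p x) -> (forall x, 0 <= q x) ->
  (dTV p q <= eps%:E)%E -> uniq s -> \sum_(x <- s) `|p x - q x| <= 2 * eps.
Proof.
move=> p0 q0 pq us; rewrite (bigID (fun x => q x <= p x))/=.
have le P : `|\sum_(x <- s | P x) (p x - q x)| <= eps.
  by rewrite -big_filter; apply: dTV_seq => //; exact: filter_uniq.
have -> : 2 * eps = eps + eps by ring.
apply: lerD.
  apply: le_trans (le (fun x => q x <= p x)); apply: le_trans (ler_norm _).
  by apply: ler_sum => x xpq; rewrite ger0_norm// subr_ge0.
apply: le_trans (le (fun x => ~~ (q x <= p x))).
rewrite -normrN -sumrN; apply: le_trans (ler_norm _).
by apply: ler_sum => x; rewrite -ltNge => xpq; rewrite ltr0_norm// subr_lt0.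
Qed.

Variables (p : 'cV[int]_d -> R) (eps : R).
Hypothesis p0 : forall x, 0 <= p x.
Hypothesis TVeps : forall j, (dTV p (shift_pmf p j) <= eps%:E)%E.

(** Triangle inequality along an outward lattice path from 0 to u. The bound for one step holds for
    all lists, hence also for the translated list at which each step is evaluated. *)
Lemma l1_shift u s : uniq s ->
  \sum_(x <- s) `|p (x - u) - p x| <= 2 * l1norm R u * eps.
Proof.
have step j s' : uniq s' -> \sum_(x <- s') `|p (x - eZ j) - p x| <= 2 * eps.
  move=> us; have := dTV_l1 p0 (fun x => p0 (x - eZ j)) (TVeps j) us.
  by under eq_bigr do rewrite distrC.
elim/lattice_ind: u s => [|u k uk IH|u k uk IH] s us.
- by rewrite big1 => [|x _]; rewrite ?l1norm0 ?mulr0 ?mul0r// subr0 subrr normr0.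
- rewrite l1normD//.
  have us' : uniq [seq x - u | x <- s] by rewrite map_inj_uniq//; exact: addIr.
  have := step k _ us'; rewrite big_map => hk; have hu := IH s us.
  apply: (@le_trans _ _ (\sum_(x <- s) (`|p (x - u - eZ k) - p (x - u)| +
      `|p (x - u) - p x|))); last by rewrite big_split/=; lra.
  apply: ler_sum => x _; rewrite opprD addrA.
  by apply: le_trans (ler_normD _ _); rewrite addrA subrK.
- rewrite l1normB//.
  have us' : uniq [seq x - u + eZ k | x <- s].
    by rewrite map_inj_uniq// => x y /addIr/addIr.
  have := step k _ us'; rewrite big_map => hk; have hu := IH s us.
  apply: (@le_trans _ _ (\sum_(x <- s) (`|p (x - u + eZ k - eZ k) - p (x - u + eZ k)| +
      `|p (x - u) - p x|))); last by rewrite big_split/=; lra.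
  apply: ler_sum => x _.
  have -> : x - (u - eZ k) = x - u + eZ k by rewrite opprB addrCA addrC.
  rewrite addrK [`|p (x - u) - p (x - u + _)|]distrC.
  by apply: le_trans (ler_normD _ _); rewrite addrA subrK.
Qed.

Variables (sB : seq 'cV[int]_d) (tau : R).
Hypothesis usB : uniq sB.
Hypothesis tail : forall s, uniq s -> (forall x, x \in s -> x \notin sB) ->
  \sum_(x <- s) p x <= tau.

(* Split p = p 1_B + p 1_{B^c} and shift the two parts separately. *)
Lemma mean_shift f M u : 0 <= M -> (forall x, x \in sB -> `|f x| <= M) ->
  (forall x, x \in sB -> `|f (x + u)| <= M) ->
  `|\sum_(x <- sB) p x * (f (x + u) - f x)| <=
  M * (2 * l1norm R u * eps + 2 * tau).
Proof.
move=> M0 fM fuM.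
pose pB x := if x \in sB then p x else 0.
pose pC x := if x \in sB then 0 else p x.
have pBC x : p x = pB x + pC x by rewrite /pB /pC; case: ifP; rewrite ?add0r ?addr0.
pose sU := [seq x + u | x <- sB].
have usU : uniq sU by rewrite map_inj_uniq//; exact: addIr.
(* [C] contains [sB] and its translate, so both sums live on one list and the difference can be
   moved from [f] to [pB]. *)
pose C := undup (sB ++ sU).
have uC : uniq C by exact: undup_uniq.
have memU y : (y \in sU) = (y - u \in sB).
  apply/mapP/idP => [[x xB ->]|yB]; first by rewrite addrK.
  by exists (y - u) => //; rewrite subrK.
have E1 : \sum_(x <- sB) p x * f (x + u) = \sum_(y <- C) pB (y - u) * f y.
  have -> : \sum_(x <- sB) p x * f (x + u) = \sum_(y <- sU) p (y - u) * f y.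
    by rewrite big_map; apply: eq_bigr => x _; rewrite addrK.
  rewrite (@sum_sub_seq _ _ _ sU C) => [|//|//|y yU]; last first.
    by rewrite mem_undup mem_cat yU orbT.
  rewrite big_mkcond; apply: eq_bigr => y _; rewrite memU /pB.
  by case: ifP; rewrite ?mul0r.
have E2 : \sum_(x <- sB) p x * f x = \sum_(y <- C) pB y * f y.
  rewrite (@sum_sub_seq _ _ _ sB C) => [|//|//|y yU]; last first.
    by rewrite mem_undup mem_cat yU.
  by rewrite big_mkcond; apply: eq_bigr => y _; rewrite /pB; case: ifP; rewrite ?mul0r.
have -> : \sum_(x <- sB) p x * (f (x + u) - f x) =
    \sum_(y <- C) (pB (y - u) - pB y) * f y.
  under eq_bigr do rewrite mulrBr; under [RHS]eq_bigr do rewrite mulrBl.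
  by rewrite !sumrB E1 E2.
apply: le_trans (ler_norm_sum _ _ _) _.
have pC0 x : 0 <= pC x by rewrite /pC; case: ifP.
apply: (@le_trans _ _ (\sum_(y <- C) M * (`|p (y - u) - p y| + (pC (y - u) + pC y)))).
  rewrite big_seq [leRHS]big_seq; apply: ler_sum => y yC.
  rewrite normrM mulrC; apply: ler_pM => //.
    move: yC; rewrite mem_undup mem_cat memU => /orP[/fM//|/fuM].
    by rewrite subrK.
  have -> : pB (y - u) - pB y = p (y - u) - p y - (pC (y - u) - pC y).
    by rewrite !pBC; ring.
  apply: le_trans (ler_normB _ _) _; rewrite lerD2l.
  by apply: le_trans (ler_normB _ _) _; rewrite !ger0_norm.
rewrite -mulr_sumr ler_wpM2l// big_split/=; apply: lerD; first exact: l1_shift.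
have pCtail s : uniq s -> \sum_(y <- s) pC y <= tau.
  move=> us; have -> : \sum_(y <- s) pC y = \sum_(y <- [seq y <- s | y \notin sB]) p y.
    by rewrite big_filter [RHS]big_mkcond; apply: eq_bigr => y _; rewrite /pC; case: ifP.
  by apply: tail => [|x]; [exact: filter_uniq|rewrite mem_filter => /andP[]].
rewrite big_split/= mulr_natl mulr2n; apply: lerD; last exact: pCtail.
have -> : \sum_(y <- C) pC (y - u) = \sum_(y <- [seq y - u | y <- C]) pC y.
  by rewrite big_map.
by apply: pCtail; rewrite map_inj_uniq//; exact: addIr.
Qed.

End TotalVariation.

(** * The Sigma-norm and the size of n *)

Section SigmaNorm.
Variables (R : realType) (d : nat) (Sig S : 'M[R]_d).
Hypotheses (d_gt0 : (0 < d)%N) (symS : symmx S) (posS : posdef S).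
Hypotheses (SS : S *m S = Sig) (symSig : symmx Sig) (posSig : posdef Sig).
Implicit Types x y : 'cV[R]_d.

Lemma snormE x : snorm Sig x = enorm (invmx S *m x).
Proof.
have uS := posdef_unitmx posS.
have symI : (invmx S)^T = invmx S by rewrite trmx_inv symS.
rewrite /snorm -SS.
have -> : invmx (S *m S) = invmx S *m invmx S.
  have uSS : S *m S \in unitmx by rewrite unitmx_mul uS.
  have e : S *m S *m (invmx S *m invmx S) = 1%:M.
    by rewrite mulmxA mulmxK// mulmxV.
  by rewrite -[LHS]mulmx1 -e mulKmx.
have -> : x^T *m (invmx S *m invmx S) *m x = (invmx S *m x)^T *m (invmx S *m x).
  by rewrite trmx_mul symI !mulmxA.
by rewrite -enorm_sqr_mx sqrtr_sqr ger0_norm// enorm_ge0.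
Qed.

Lemma snorm_ge0 x : 0 <= snorm Sig x.
Proof. exact: sqrtr_ge0. Qed.

Lemma ler_snormD x y : snorm Sig (x + y) <= snorm Sig x + snorm Sig y.
Proof. by rewrite !snormE mulmxDr ler_enormD. Qed.

Lemma enorm_sqr_snorm x :
  enorm x ^+ 2 = ((invmx S *m x)^T *m Sig *m (invmx S *m x)) 0 0.
Proof.
have uS := posdef_unitmx posS.
have -> : (invmx S *m x)^T *m Sig *m (invmx S *m x) = x^T *m x.
  rewrite -SS trmx_mul trmx_inv symS -!mulmxA.
  by rewrite mulKVmx// mulKmx.
exact: enorm_sqr_mx.
Qed.

Lemma enorm_sqr_le_snorm x : enorm x ^+ 2 <= lam_max Sig * snorm Sig x ^+ 2.
Proof.
rewrite enorm_sqr_snorm snormE; have [_ h] := lam_max_rayleigh d_gt0 symSig.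
exact: h.
Qed.

Lemma enorm_sqr_ge_snorm x : lam_min Sig * snorm Sig x ^+ 2 <= enorm x ^+ 2.
Proof.
rewrite enorm_sqr_snorm snormE; have [_ h] := lam_min_rayleigh d_gt0 symSig.
exact: h.
Qed.

Lemma lam_max_Sig_gt0 : 0 < lam_max Sig.
Proof.
by apply: lt_le_trans (lam_min_le_max d_gt0 symSig); exact: posdef_lam_min_gt0.
Qed.

Lemma enorm_le_snorm x : enorm x <= Num.sqrt (lam_max Sig) * snorm Sig x.
Proof.
rewrite -(ler_pXn2r (_ : (0 < 2)%N))// ?nnegrE ?mulr_ge0 ?enorm_ge0 ?sqrtr_ge0//.
rewrite exprMn [Num.sqrt (lam_max _) ^+ 2]sqr_sqrtr ?enorm_sqr_le_snorm//.
exact: ltW lam_max_Sig_gt0.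
Qed.

(** Lattice points on the way to a jump are known to be shorter than the jump only in the Euclidean
    norm; the square root of the condition number is the price in the Sigma-norm. *)
Lemma snorm_le_rho x y : enorm x <= enorm y ->
  snorm Sig x <= Num.sqrt (rho Sig) * snorm Sig y.
Proof.
move=> xy; have m0 := posdef_lam_min_gt0 d_gt0 symSig posSig.
have r1 := posdef_rho_ge1 d_gt0 symSig posSig.
rewrite -(ler_pXn2r (_ : (0 < 2)%N))// ?nnegrE ?mulr_ge0 ?snorm_ge0 ?sqrtr_ge0//.
rewrite exprMn [Num.sqrt (rho _) ^+ 2]sqr_sqrtr; last by lra.
rewrite /rho mulrAC ler_pdivlMr// mulrC.
apply: le_trans (enorm_sqr_ge_snorm x) _.
apply: le_trans (enorm_sqr_le_snorm y).
by rewrite ler_pXn2r// nnegrE enorm_ge0.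
Qed.

(** Finiteness makes the sum over the ball a finite sum and the suprema in [normD1] and [normD2]
    true bounds. The strict bound [|X i| < K] lets [X i + K] be coded as an ordinal below
    [K + K]. *)
Lemma snorm_ball_finite (z : 'cV[R]_d) (a : R) :
  finite_set [set X : 'cV[int]_d | snorm Sig (toR X - z) <= a].
Proof.
pose K := (Num.truncn (Num.sqrt (lam_max Sig) * a + enorm z)).+1.
pose F (o : 'cV['I_(K + K)]_d) : 'cV[int]_d := \col_i ((o i 0 : nat)%:Z - K%:Z).
apply: (@sub_finite_set _ _ (F @` setT)); last exact/finite_image/finite_finset.
move=> X /= Xa.
have Xb i : `|(X i 0)%:~R| < K%:R :> R.
  have s0 := sqrtr_ge0 (lam_max Sig).
  have le : enorm (toR X : 'cV[R]_d) <= Num.sqrt (lam_max Sig) * a + enorm z.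
    rewrite -[toR X](subrK z); apply: le_trans (ler_enormD _ _) _.
    rewrite lerD2r; apply: le_trans (enorm_le_snorm _) _.
    by rewrite ler_wpM2l.
  have := coord_le_enorm (toR X : 'cV[R]_d) i; rewrite mxE => h.
  by apply: le_lt_trans (le_trans h le) _; exact: truncnS_gt.
have Xi i : (absz (X i 0 + K%:Z)%R < K + K)%N /\ (0 <= X i 0 + K%:Z).
  have := Xb i; rewrite -intr_norm -[K%:R]/(K%:~R) ltr_int.
  by move: (X i 0) => z'; lia.
exists (\col_i Ordinal (proj1 (Xi i))) => //.
apply/colP => i; rewrite !mxE/=; have [_] := Xi i.
by move: (X i 0) => z'; lia.
Qed.

End SigmaNorm.

Section LatticeNorms.
Variables (R : realType) (d : nat) (Sig : 'M[R]_d) (c : 'cV[R]_d) (n : nat).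
Variables (h : 'cV[int]_d -> R) (a : R).
Hypothesis fin : finite_set [set X : 'cV[int]_d | snorm Sig (toR X - n%:R *: c) <= a].

Lemma sup_nonneg (E : set R) : (forall x, E x -> 0 <= x) -> 0 <= sup E.
Proof.
move=> E0; have [hs|/sup_out ->//] := pselect (has_sup E).
by have [[x Ex] ub] := hs; apply: le_trans (E0 _ Ex) _; exact: ub_le_sup.
Qed.

Lemma normD1_ge0 : 0 <= normD1 Sig c n h a.
Proof. by apply: sup_nonneg => _ [X [j [_ ->]]]. Qed.

Lemma normD2_ge0 : 0 <= normD2 Sig c n h a.
Proof. by apply: sup_nonneg => _ [X [j [k [_ ->]]]]. Qed.

Lemma finite_ball_bounded (f : 'cV[int]_d -> R) : exists K, forall X,
  snorm Sig (toR X - n%:R *: c) <= a -> `|f X| <= K.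
Proof.
move: fin => /finite_seqP[s hs].
exists (\sum_(X <- s) `|f X|) => X Xa.
have Xs : X \in s by have : [set` s] X by rewrite -hs.
by rewrite (big_rem X)//= lerDl sumr_ge0.
Qed.

Lemma le_normD1 X j : snorm Sig (toR X - n%:R *: c) <= a ->
  `|D1 h j X| <= normD1 Sig c n h a.
Proof.
move=> Xa; apply: ub_le_sup; last by exists X, j.
have [K hK] := choice (fun j => finite_ball_bounded (D1 h j)).
exists (\sum_j `|K j|) => _ [Y [i [Ya ->]]].
apply: le_trans (hK i _ Ya) _; apply: le_trans (ler_norm _) _.
by rewrite (bigD1 i)//= lerDl sumr_ge0.
Qed.

Lemma le_normD2 X j k : snorm Sig (toR X - n%:R *: c) <= a ->
  `|D2 h j k X| <= normD2 Sig c n h a.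
Proof.
move=> Xa; apply: ub_le_sup; last by exists X, j, k.
have [K hK] := choice (fun jk : 'I_d * 'I_d => finite_ball_bounded (D2 h jk.1 jk.2)).
exists (\sum_jk `|K jk|) => _ [Y [i [l [Ya ->]]]].
apply: le_trans (hK (i, l) _ Ya) _; apply: le_trans (ler_norm _) _.
by rewrite (bigD1 (i, l))//= lerDl sumr_ge0.
Qed.

End LatticeNorms.

Section Scales.
Variables (R : realType) (d : nat).
Implicit Types (th eta delta rh Jm : R) (m n : nat).

(** This is [e <= 4]: from [expR (- 1/2) >= 1/2] one gets [expR (1/2) <= 2], which is then
    squared. *)
Lemma ln_ge1 m : (4 <= m)%N -> 1 <= ln m%:R :> R.
Proof.
move=> m4; have m0 : 0 < m%:R :> R by rewrite ltr0n; lia.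
rewrite -ler_expR lnK ?posrE//.
have : 4 <= m%:R :> R by rewrite ler_nat.
apply: le_trans; have e0 := expR_gt0 (2^-1 : R).
have h : expR (2^-1 : R) <= 2.
  have := expR_ge1Dx (- 2^-1 : R); rewrite expRN => h.
  have : 2^-1 <= (expR (2^-1 : R))^-1 by lra.
  by rewrite lef_pV2 ?posrE.
have -> : expR 1 = expR (2^-1) * expR (2^-1) :> R.
  by rewrite -expRD; congr expR; lra.
nra.
Qed.

(** Needed because [inf] of an empty set is 0, which would make [psi_inv <= n] carry no information.
    At [m = k ^ 4] the power [m^(3/4)] is [k ^ 3] while [ln m <= 4 k], so [k >= 64 / (T * eta ^ 2)]
    suffices; the offset 2 in [k] ensures [m >= 4]. *)
Lemma psi_vanishes th1 eta : 0 < d%:R * th1 -> 0 < eta ->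
  exists2 m, (4 <= m)%N & psi d th1 m <= eta.
Proof.
rewrite /psi => + e0; move: (d%:R * th1) => T T0.
pose k := (Num.truncn (64 / (T * eta ^+ 2))).+2.
have kR : 64 / (T * eta ^+ 2) <= k%:R.
  apply: ltW; apply: lt_trans (truncnS_gt _) _; by rewrite ltr_nat.
have k0 : 0 < k%:R :> R by rewrite ltr0n.
have k1 : 1 <= k%:R :> R by rewrite ler1n.
have Te : 0 < T * eta ^+ 2 by rewrite mulr_gt0// exprn_gt0.
exists (k ^ 4)%N.
  by apply: (@leq_trans (2 ^ 4)) => //; rewrite leq_exp2r.
have e34 : powR (k ^ 4)%:R (3 / 4) = k%:R ^+ 3 :> R.
  rewrite natrX -!powR_mulrn ?ltW// -powRrM; congr powR; lra.
rewrite e34 natrX lnXn//.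
have lnk : ln k%:R <= k%:R :> R.
  by have := @le_ln1Dx R (k%:R - 1); rewrite addrCA subrr addr0 => h; have := h; lra.
have le : ln k%:R *+ 4 / (T * k%:R ^+ 3) <= (eta / 4) ^+ 2.
  rewrite ler_pdivrMr ?mulr_gt0 ?exprn_gt0//.
  move: kR; rewrite ler_pdivrMr// => kR.
  rewrite -[ln _ *+ 4]mulr_natl.
  have h1 : 64 <= k%:R ^+ 2 * (T * eta ^+ 2) by nra.
  have h2 : 64 * k%:R <= k%:R ^+ 3 * (T * eta ^+ 2).
    by have := ler_wpM2r (ltW k0) h1; rewrite (exprS _ 2); lra.
  by move: h2 lnk; lra.
have := le; rewrite -ler_sqrt ?sqr_ge0// sqrtr_sqr ger0_norm; lra.
Qed.

Lemma psi_inv_attained th1 eta n : 0 < d%:R * th1 -> 0 < eta ->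
  psi_inv d th1 eta <= n%:R -> exists2 m, (4 <= m <= n)%N & psi d th1 m <= eta.
Proof.
move=> T0 e0 le; have [m0 m04 pm0] := psi_vanishes T0 e0.
(* A strict comparison with [n.+1] produces a natural number below it, hence at most n. *)
have [||_ [m [m4 pm] <-]] := @inf_lt R [set m%:R | m in
    [set m : nat | (4 <= m)%N /\ psi d th1 m <= eta]] (n.+1)%:R.
- by exists m0%:R, m0.
- by apply: le_lt_trans le _; rewrite ltr_nat.
by rewrite ltr_nat ltnS => mn; exists m => //; rewrite m4.
Qed.

(** The witness m may be smaller than n. Bounding [ln m] below by 1 and [m^(3/4)] above by [n^(3/4)]
    carries the estimate over to n; 16 is the square of the factor 4 in [psi]. *)
Lemma psi_inv_bound th1 eta n : 0 < d%:R * th1 -> 0 < eta ->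
  psi_inv d th1 eta <= n%:R ->
  16 <= eta ^+ 2 * (d%:R * th1) * powR n%:R (3 / 4).
Proof.
move=> T0 e0 /(psi_inv_attained T0 e0)[m /andP[m4 mn]].
rewrite /psi; move: (d%:R * th1) T0 => T T0 le.
have m0 : 0 < m%:R :> R by rewrite ltr0n; lia.
have P0 : 0 < powR m%:R (3 / 4) :> R by rewrite powR_gt0.
have mnP : powR m%:R (3 / 4) <= powR n%:R (3 / 4) :> R.
  by apply: ge0_ler_powR; rewrite ?nnegrE ?ler0n ?ler_nat//; lra.
have ln1 := ln_ge1 m4.
have q0 : 0 <= ln m%:R / (T * powR m%:R (3 / 4)).
  by apply: divr_ge0; [lra|rewrite mulr_ge0 ?powR_ge0// ltW].
have sq : ln m%:R / (T * powR m%:R (3 / 4)) <= (eta / 4) ^+ 2.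
  have s0 := sqrtr_ge0 (ln m%:R / (T * powR m%:R (3 / 4))).
  rewrite -[leLHS]sqr_sqrtr// ler_pXn2r ?nnegrE//; first lra.
  by rewrite divr_ge0//; exact: ltW.
move: sq; rewrite ler_pdivrMr ?mulr_gt0// => sq.
have h : 16 <= eta ^+ 2 * T * powR m%:R (3 / 4) by move: sq; lra.
apply: le_trans h _; rewrite ler_wpM2l// mulr_ge0 ?sqr_ge0//; exact: ltW.
Qed.

(** With [y = n^(3/8)], the bound through [psi_inv] and [T <= 1 / (64 * rh)] give
    [64 * sqrt rh <= delta * y], and the other lower bound on n gives [5 * Jm <= d * y]. Their
    product has [320 = 64 * 5] on the left, and [d <= n^(1/4)] turns [d * y ^ 2] into at most n. *)
Lemma scale_bound th1 delta rh Jm n : (0 < d)%N -> (d ^ 4 <= n)%N ->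
  0 < d%:R * th1 -> d%:R * th1 <= 1 / (64 * rh) -> 1 <= rh -> 0 <= Jm ->
  0 < delta -> psi_inv d th1 (delta / 2) <= n%:R ->
  powR (5 * d%:R^-1 * Jm * Num.max 1 (Num.sqrt (d%:R * th1))) (8 / 3) <= n%:R ->
  Num.sqrt rh * Jm <= n%:R * delta / 320.
Proof.
move=> d0 dn T0 Tr r1 J0 D0 hpsi hJ.
have dR0 : 0 < d%:R :> R by rewrite ltr0n.
have n0 : 0 < n%:R :> R.
  by rewrite ltr0n; apply: leq_trans dn; rewrite expn_gt0 d0.
have {hpsi} := psi_inv_bound T0 (divr_gt0 D0 (ltr0Sn _ 1)) hpsi.
set T := d%:R * th1 in T0 Tr hJ *.
set y := powR n%:R (3 / 8) : R.
have y0 : 0 < y by rewrite powR_gt0.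
have yy : powR n%:R (3 / 4) = y ^+ 2 :> R.
  by rewrite -powR_mulrn ?ltW// -powRrM; congr powR; lra.
rewrite yy => hpsi.
have dy : d%:R * y ^+ 2 <= n%:R.
  have -> : n%:R = powR n%:R (1 / 4) * y ^+ 2 :> R.
    rewrite -yy -powRD; last by rewrite gt_eqF ?implybT.
    by rewrite (_ : 1 / 4 + 3 / 4 = 1) ?powRr1 ?ltW//; lra.
  rewrite ler_wpM2r ?sqr_ge0//.
  have -> : d%:R = powR (d ^ 4)%:R (1 / 4) :> R.
    rewrite natrX -powR_mulrn ?ltW// -powRrM.
    by rewrite (_ : 4%:R * (1 / 4) = 1) ?powRr1 ?ltW//; lra.
  by apply: ge0_ler_powR; rewrite ?nnegrE ?ler0n ?ler_nat//; lra.
set z := 5 * d%:R^-1 * Jm * _ in hJ.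
have w0 : 0 <= 5 * d%:R^-1 * Jm by rewrite !mulr_ge0// invr_ge0 ltW.
have mx : 1 <= Num.max 1 (Num.sqrt T) by rewrite le_max lexx.
have wz : 5 * d%:R^-1 * Jm <= z by rewrite ler_peMr.
have z0 : 0 <= z by exact: le_trans wz.
have zy : z <= y.
  have -> : z = powR (powR z (8 / 3)) (3 / 8).
    by rewrite -powRrM (_ : 8 / 3 * (3 / 8) = 1) ?powRr1//; lra.
  by apply: ge0_ler_powR; rewrite ?nnegrE ?powR_ge0 ?ler0n//; lra.
have Jy : 5 * Jm <= d%:R * y.
  have := le_trans wz zy.
  by rewrite mulrAC ler_pdivrMr// [y * _]mulrC.
have r0 : 0 < 64 * rh by lra.
have Tr1 : T * (64 * rh) <= 1 by rewrite -ler_pdivlMr.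
have sr : 64 * Num.sqrt rh <= delta * y.
  have s0 := sqrtr_ge0 rh.
  rewrite -(ler_pXn2r (_ : (0 < 2)%N))// ?nnegrE ?mulr_ge0 ?(ltW D0) ?(ltW y0)//.
  rewrite !exprMn sqr_sqrtr; last by lra.
  have hd : 64 <= delta ^+ 2 * y ^+ 2 * T by move: hpsi; lra.
  have dy0 : 0 <= delta ^+ 2 * y ^+ 2 by rewrite mulr_ge0// sqr_ge0.
  have h1 := ler_wpM2r (ltW r0) hd.
  have h2 := ler_wpM2l dy0 Tr1.
  have -> : 64 ^+ 2 = 64 * 64 :> R by ring.
  by move: h1 h2; lra.
have h3 : (64 * Num.sqrt rh) * (5 * Jm) <= (delta * y) * (d%:R * y).
  by apply: ler_pM => //; rewrite mulr_ge0// sqrtr_ge0.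
have h4 := ler_wpM2l (ltW D0) dy.
by move: h3 h4; lra.
Qed.

End Scales.

(** * The generator *)

Section Generator.
Variables (R : realType) (d n : nat) (Js : seq 'cV[int]_d).
Variables (g : 'cV[int]_d -> 'cV[R]_d -> R) (c : 'cV[R]_d).
Variable h : 'cV[int]_d -> R.
Hypothesis drift0 : Fdrift Js g c = 0.
Hypothesis n_gt0 : 0 < n%:R :> R.
Implicit Types (J X : 'cV[int]_d).

Let x X : 'cV[R]_d := n%:R^-1 *: toR X.

Definition rate_rem J X := g J (x X) - g J c
  - \sum_j (x X - c) j 0 * partial (g J) j c.

Definition first_diff J X := \sum_i (J i 0)%:~R * D1 h i X.

(** Zero drift tested against an arbitrary vector. It is used with the first differences, with the
    diagonal second differences, and with the constant 1 to remove [coord_sum]. *)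
Lemma drift_sum0 (f : 'I_d -> R) :
  \sum_(J <- Js) g J c * \sum_i (J i 0)%:~R * f i = 0.
Proof.
under eq_bigr do rewrite mulr_sumr.
rewrite exchange_big/= big1// => i _.
under eq_bigr do rewrite mulrA; rewrite -mulr_suml.
have : Fdrift Js g c i 0 = 0 by rewrite drift0 mxE.
rewrite /Fdrift summxE; under eq_bigr do rewrite !mxE.
by move=> ->; rewrite mul0r.
Qed.

Lemma trace_sigma2_D2 X : \tr (sigma2 Js g c *m D2mat h X) =
  \sum_(J <- Js) g J c *
    \sum_i \sum_j (J i 0)%:~R * (J j 0)%:~R * D2 h i j X.
Proof.
under [RHS]eq_bigr do rewrite mulr_sumr.
rewrite exchange_big/=; apply: eq_bigr => i _; rewrite mxE.
under [RHS]eq_bigr do rewrite mulr_sumr.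
rewrite exchange_big/=; apply: eq_bigr => j _; rewrite summxE mulr_suml.
apply: eq_bigr => J _; rewrite !mxE big_ord1 !mxE (D2_sym h j i); ring.
Qed.

Lemma scaled_center X : toR X - n%:R *: c = n%:R *: (x X - c).
Proof. by rewrite scalerBr scalerA divff ?scale1r// gt_eqF. Qed.

Lemma jacobian_term X :
  ((D1vec h X)^T *m DF Js g c *m (toR X - n%:R *: c)) 0 0 =
  n%:R * \sum_(J <- Js) (\sum_j (x X - c) j 0 * partial (g J) j c) * first_diff J X.
Proof.
rewrite scaled_center -scalemxAr mxE; congr (_ * _); rewrite mxE.
under [RHS]eq_bigr do rewrite mulr_suml.
rewrite exchange_big/=; apply: eq_bigr => j _; rewrite mxE mulr_suml.
under [RHS]eq_bigr do rewrite mulr_sumr.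
rewrite exchange_big/=; apply: eq_bigr => i _.
rewrite [(D1vec _ _)^T _ _]mxE [D1vec _ _ _ _]mxE [DF _ _ _ _ _]mxE mulr_sumr mulr_suml.
by apply: eq_bigr => J _; rewrite [toR J _ _]mxE; ring.
Qed.

(* The drift condition removes both the constant part of the first-order term
   and the diagonal correction hidden in the second-order remainder. *)
Lemma generator_decomp X :
  n%:R * \sum_(J <- Js) g J (x X) * (h (X + J) - h X)
    - Atil (sigma2 Js g c) (DF Js g c) c n h X =
  n%:R * (\sum_(J <- Js) rate_rem J X * first_diff J X
    + \sum_(J <- Js) (g J (x X) - g J c) * taylor1_rem h J X
    + \sum_(J <- Js) g J c * taylor2_rem h J X).
Proof.
rewrite /Atil trace_sigma2_D2 jacobian_term.
have f0 := drift_sum0 (fun i => D1 h i X).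
have d0 := drift_sum0 (fun i => D2 h i i X).
set b := fun J => \sum_j (x X - c) j 0 * partial (g J) j c.
set q := fun J => \sum_i \sum_j (J i 0)%:~R * (J j 0)%:~R * D2 h i j X.
set w := fun J => \sum_i (J i 0)%:~R * D2 h i i X.
have -> : \sum_(J <- Js) g J (x X) * (h (X + J) - h X) =
    \sum_(J <- Js) rate_rem J X * first_diff J X
    + \sum_(J <- Js) (g J (x X) - g J c) * taylor1_rem h J X
    + \sum_(J <- Js) g J c * taylor2_rem h J X
    + \sum_(J <- Js) b J * first_diff J X
    + \sum_(J <- Js) g J c * first_diff J X
    + 2^-1 * \sum_(J <- Js) g J c * q J - 2^-1 * \sum_(J <- Js) g J c * w J.
  rewrite !mulr_sumr -!big_split/= -sumrB; apply: eq_bigr => J _.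
  rewrite /rate_rem -/(b J) /taylor2_rem -/(q J) -/(w J) /taylor1_rem.
  by rewrite -/(first_diff J X); ring.
rewrite -/(\sum_(J <- Js) g J c * first_diff J X) in f0.
by rewrite f0 d0; ring.
Qed.

End Generator.

(** Instead of Cauchy-Schwarz: [2 * t * N <= N ^ 2 + t ^ 2] at the optimal [t = sqrt V]. *)
Lemma first_moment_le (R : realType) (T : eqType) (s : seq T) (p N : T -> R) (V : R) :
  (forall x, 0 <= p x) -> 0 < V -> \sum_(x <- s) p x <= 1 ->
  \sum_(x <- s) p x * N x ^+ 2 <= V -> \sum_(x <- s) p x * N x <= Num.sqrt V.
Proof.
move=> p0 V0 p1 pV; set t := Num.sqrt V.
have t0 : 0 < t by rewrite sqrtr_gt0.
have tt : t ^+ 2 = V by rewrite sqr_sqrtr// ltW.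
rewrite -(ler_pM2l (_ : 0 < 2 * t)); last by lra.
apply: (@le_trans _ _ (\sum_(x <- s) (p x * N x ^+ 2 + t ^+ 2 * p x))).
  rewrite mulr_sumr; apply: ler_sum => y _.
  have : 0 <= p y * (N y - t) ^+ 2 by rewrite mulr_ge0// sqr_ge0.
  lra.
rewrite big_split/= -mulr_sumr.
have : t ^+ 2 * \sum_(x <- s) p x <= t ^+ 2 by rewrite ler_piMr// sqr_ge0.
move: pV; rewrite -tt; lra.
Qed.

Lemma bigmax_seq_bound (R : realType) (T : eqType) (s : seq T) (f : T -> R) y :
  y \in s -> f y <= \big[Num.max/0]_(z <- s) f z.
Proof. by move=> ys; apply: le_bigmax_seq. Qed.

Lemma bigmax_seq_ge0 (R : realType) (T : eqType) (s : seq T) (f : T -> R) :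
  0 <= \big[Num.max/0]_(z <- s) f z.
Proof. exact: bigmax_ge_id. Qed.

(** * The three parts of the generator difference, averaged over a finite set *)

Section GeneratorBound.
Variables (R : realType) (d n : nat) (Js : seq 'cV[int]_d).
Variables (g : 'cV[int]_d -> 'cV[R]_d -> R) (c : 'cV[R]_d) (Sig : 'M[R]_d).
Variables (h p : 'cV[int]_d -> R) (sB : seq 'cV[int]_d).
Variables (L1 L2 Lmax N1 M V eps kap : R).
Hypotheses (n_gt0 : 0 < n%:R :> R) (p0 : forall X, 0 <= p X).
Hypotheses (a0 : forall J, J \in Js -> 0 <= g J c).
Hypotheses (L1_ge0 : 0 <= L1) (L2_ge0 : 0 <= L2) (Lmax_ge0 : 0 <= Lmax).
Hypotheses (N1_ge0 : 0 <= N1) (M_ge0 : 0 <= M) (V_gt0 : 0 < V) (eps_ge0 : 0 <= eps).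
Hypotheses (kap_ge0 : 0 <= kap) (drift0 : Fdrift Js g c = 0).
Implicit Types (J X : 'cV[int]_d).

Let x X : 'cV[R]_d := n%:R^-1 *: toR X.
Let N X : R := snorm Sig (toR X - n%:R *: c).
Let t2 : R := \sum_(J <- Js) g J c * enorm (toR J : 'cV[R]_d) ^+ 2.
Let t3 : R := \sum_(J <- Js) g J c * enorm (toR J : 'cV[R]_d) ^+ 3.

Hypothesis mass : \sum_(X <- sB) p X <= 1.
Hypothesis moment2 : \sum_(X <- sB) p X * N X ^+ 2 <= V.
Hypothesis enorm_N : forall X,
  enorm (toR X - n%:R *: c) <= Num.sqrt Lmax * N X.
Hypothesis grad_b : forall J X, J \in Js -> X \in sB ->
  `|g J (x X) - g J c| <= L1 * g J c * enorm (x X - c).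
Hypothesis hess_b : forall J X, J \in Js -> X \in sB ->
  `|rate_rem n g c J X| <= L2 * g J c * enorm (x X - c) ^+ 2 / 2.
Hypothesis D1_b : forall i X, X \in sB -> `|D1 h i X| <= N1.
Hypothesis D2_b : forall J u i j X, J \in Js -> X \in sB ->
  enorm (toR u : 'cV[R]_d) <= enorm (toR J : 'cV[R]_d) -> `|D2 h i j (X + u)| <= M.
Hypothesis shift_b : forall J u i j, J \in Js ->
  enorm (toR u : 'cV[R]_d) <= enorm (toR J : 'cV[R]_d) ->
  `|\sum_(X <- sB) p X * (D2 h i j (X + u) - D2 h i j X)| <=
  M * (2 * l1norm R u * eps + kap).

Lemma enorm_scaled X : enorm (x X - c) <= n%:R^-1 * (Num.sqrt Lmax * N X).
Proof.
rewrite -ler_pdivrMl ?invr_gt0// invrK; apply: le_trans (enorm_N X).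
by rewrite scaled_center// enormZ gtr0_norm.
Qed.

Lemma first_diff_le J X : X \in sB ->
  `|first_diff h J X| <= enorm (toR J : 'cV[R]_d) ^+ 2 * N1.
Proof.
move=> XB; apply: le_trans (ler_wpM2r N1_ge0 (l1norm_le_enorm_sqr R J)).
rewrite mulr_suml; apply: le_trans (ler_norm_sum _ _ _) _.
by apply: ler_sum => i _; rewrite normrM ler_wpM2l// D1_b.
Qed.

Lemma drift_rem_sum :
  \sum_(X <- sB) p X * `|\sum_(J <- Js) rate_rem n g c J X * first_diff h J X| <=
  L2 / 2 * n%:R^-1 ^+ 2 * Lmax * N1 * t2 * V.
Proof.
have t20 : 0 <= t2.
  by rewrite /t2 big_seq sumr_ge0// => J JJ; rewrite mulr_ge0 ?sqr_ge0 ?a0.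
have C0 : 0 <= L2 / 2 * n%:R^-1 ^+ 2 * Lmax * N1 * t2.
  by rewrite !mulr_ge0// ?sqr_ge0.
apply: le_trans (ler_wpM2l C0 moment2).
rewrite mulr_sumr big_seq [leRHS]big_seq; apply: ler_sum => X XB.
rewrite [leRHS]mulrCA ler_wpM2l//.
apply: le_trans (ler_norm_sum _ _ _) _.
have -> : L2 / 2 * n%:R^-1 ^+ 2 * Lmax * N1 * t2 * N X ^+ 2 =
    \sum_(J <- Js) (L2 * g J c * (n%:R^-1 ^+ 2 * (Lmax * N X ^+ 2)) / 2) *
      (enorm (toR J : 'cV[R]_d) ^+ 2 * N1).
  rewrite /t2 mulr_sumr mulr_suml; apply: eq_bigr => J _; ring.
rewrite big_seq [leRHS]big_seq; apply: ler_sum => J JJ; rewrite normrM.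
apply: ler_pM => //; last exact: first_diff_le.
apply: le_trans (hess_b JJ XB) _.
rewrite ler_pM2r ?invr_gt0// ler_wpM2l ?mulr_ge0 ?a0//.
have -> : n%:R^-1 ^+ 2 * (Lmax * N X ^+ 2) =
    (n%:R^-1 * (Num.sqrt Lmax * N X)) ^+ 2 by rewrite !exprMn [Num.sqrt Lmax ^+ 2]sqr_sqrtr.
rewrite ler_pXn2r ?nnegrE ?enorm_ge0 ?enorm_scaled//.
exact: le_trans (enorm_ge0 _) (enorm_scaled X).
Qed.

Lemma rate_diff_sum :
  \sum_(X <- sB) p X *
    `|\sum_(J <- Js) (g J (x X) - g J c) * taylor1_rem h J X| <=
  L1 * n%:R^-1 * Num.sqrt Lmax * M * d%:R * t2 * Num.sqrt V.
Proof.
have t20 : 0 <= t2.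
  by rewrite /t2 big_seq sumr_ge0// => J JJ; rewrite mulr_ge0 ?sqr_ge0 ?a0.
have C0 : 0 <= L1 * n%:R^-1 * Num.sqrt Lmax * M * d%:R * t2.
  by rewrite !mulr_ge0// ?invr_ge0 ?ltW// sqrtr_ge0.
apply: le_trans (ler_wpM2l C0 (first_moment_le p0 V_gt0 mass moment2)).
rewrite mulr_sumr big_seq [leRHS]big_seq; apply: ler_sum => X XB.
rewrite [leRHS]mulrCA ler_wpM2l//.
apply: le_trans (ler_norm_sum _ _ _) _.
have -> : L1 * n%:R^-1 * Num.sqrt Lmax * M * d%:R * t2 * N X =
    \sum_(J <- Js) (L1 * g J c * (n%:R^-1 * (Num.sqrt Lmax * N X))) *
      (M * (d%:R * enorm (toR J : 'cV[R]_d) ^+ 2)).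
  rewrite /t2 mulr_sumr mulr_suml; apply: eq_bigr => J _; ring.
rewrite big_seq [leRHS]big_seq; apply: ler_sum => J JJ; rewrite normrM.
apply: ler_pM => //.
  apply: le_trans (grad_b JJ XB) _.
  by rewrite ler_wpM2l ?mulr_ge0 ?a0// enorm_scaled.
apply: (@le_trans _ _ (M * l1norm R J ^+ 2)).
  apply: (@taylor1_rem_bound _ _ _ (enorm (toR J : 'cV[R]_d))) => // u i j.
  exact: D2_b.
by rewrite ler_wpM2l// l1norm_sqr_le.
Qed.

Lemma second_order_sum :
  `|\sum_(X <- sB) p X * \sum_(J <- Js) g J c * taylor2_rem h J X| <=
  M * (eps * (Num.sqrt d%:R ^+ 3 * t3) + kap * (d%:R * t2)).
Proof.
have -> : \sum_(X <- sB) p X * (\sum_(J <- Js) g J c * taylor2_rem h J X) =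
    \sum_(J <- Js) g J c * \sum_(X <- sB) p X * taylor2_rem h J X.
  under eq_bigr do rewrite mulr_sumr.
  rewrite exchange_big/=; apply: eq_bigr => J _; rewrite mulr_sumr.
  by apply: eq_bigr => X _; ring.
apply: le_trans (ler_norm_sum _ _ _) _.
(* Zero drift makes the [- coord_sum] corrections cancel after summation over the jumps; the cubes
   of [l1norm] that remain cost [d^(3/2)] in Euclidean length. *)
have cs0 : \sum_(J <- Js) g J c * coord_sum R J = 0.
  rewrite -[RHS](drift_sum0 drift0 (fun=> 1)); apply: eq_bigr => J _.
  by rewrite /coord_sum; under [in RHS]eq_bigr do rewrite mulr1.
apply: (@le_trans _ _ (\sum_(J <- Js) g J c *
    (M * (eps * (l1norm R J ^+ 3 - coord_sum R J) + kap * l1norm R J ^+ 2)))).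
  rewrite big_seq [leRHS]big_seq; apply: ler_sum => J JJ.
  rewrite normrM ger0_norm ?a0// ler_wpM2l ?a0//.
  apply: (@mean_taylor2_rem_bound _ _ _ (enorm (toR J : 'cV[R]_d))) => // u i j.
  exact: shift_b.
have -> : \sum_(J <- Js) g J c *
    (M * (eps * (l1norm R J ^+ 3 - coord_sum R J) + kap * l1norm R J ^+ 2)) =
    M * (eps * \sum_(J <- Js) g J c * l1norm R J ^+ 3
         + kap * \sum_(J <- Js) g J c * l1norm R J ^+ 2)
    - M * eps * \sum_(J <- Js) g J c * coord_sum R J.
  rewrite !mulr_sumr -big_split/= mulr_sumr -sumrB.
  by apply: eq_bigr => J _; ring.
rewrite cs0 mulr0 subr0 ler_wpM2l//; apply: lerD; rewrite ler_wpM2l//.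
  rewrite /t3 mulr_sumr big_seq [leRHS]big_seq; apply: ler_sum => J JJ.
  rewrite [leRHS]mulrCA ler_wpM2l ?a0// -exprMn.
  rewrite ler_pXn2r ?nnegrE ?l1norm_ge0 ?mulr_ge0 ?sqrtr_ge0//.
  rewrite -(ler_pXn2r (_ : (0 < 2)%N))// ?nnegrE ?l1norm_ge0 ?mulr_ge0 ?sqrtr_ge0//.
  by rewrite exprMn [Num.sqrt d%:R ^+ 2]sqr_sqrtr ?ler0n// l1norm_sqr_le.
rewrite /t2 mulr_sumr big_seq [leRHS]big_seq; apply: ler_sum => J JJ.
by rewrite [leRHS]mulrCA ler_wpM2l ?a0// l1norm_sqr_le.
Qed.

(** Absolute values are taken inside the expectation for the first two parts. The third keeps its
    signs, because it is small only after averaging. *)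
Lemma mean_generator_diff :
  `|\sum_(X <- sB) p X * (n%:R * \sum_(J <- Js) g J (x X) * (h (X + J) - h X)
      - Atil (sigma2 Js g c) (DF Js g c) c n h X)| <=
  n%:R * (L2 / 2 * n%:R^-1 ^+ 2 * Lmax * N1 * t2 * V
    + L1 * n%:R^-1 * Num.sqrt Lmax * M * d%:R * t2 * Num.sqrt V
    + M * (eps * (Num.sqrt d%:R ^+ 3 * t3) + kap * (d%:R * t2))).
Proof.
under eq_bigr do rewrite (generator_decomp h drift0 n_gt0) mulrCA.
rewrite -mulr_sumr normrM gtr0_norm// ler_pM2l//.
under eq_bigr do rewrite !mulrDr.
rewrite !big_split/=; apply: le_trans (ler_normD _ _) _.
apply: lerD second_order_sum; apply: le_trans (ler_normD _ _) _.
apply: lerD; apply: le_trans (ler_norm_sum _ _ _) _.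
  apply: le_trans drift_rem_sum.
  by apply: ler_sum => X _; rewrite normrM (ger0_norm (p0 _)).
apply: le_trans rate_diff_sum.
by apply: ler_sum => X _; rewrite normrM (ger0_norm (p0 _)).
Qed.

End GeneratorBound.

(** * The jump set and positive definiteness of the diffusion matrix *)

Section JumpSet.
Variables (R : realType) (d : nat) (Js : seq 'cV[int]_d).
Variables (g : 'cV[int]_d -> 'cV[R]_d -> R) (c : 'cV[R]_d).
Hypothesis generating : forall j : 'I_d, exists s : seq 'cV[int]_d,
  all (fun J => J \in Js) s /\ \sum_(J <- s) J = eZ j.

(** A sum of zero jumps cannot be a unit vector. The resulting jump keeps [L0], [Jmax] and the trace
    of [sigma2] away from 0. *)
Lemma nonzero_jump : (0 < d)%N -> exists2 J, J \in Js & J != 0.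
Proof.
move=> d0; have [s [/allP sJs sumJ]] := generating (Ordinal d0).
have [/hasP[J Js' J0]|/hasPn s0] := boolP (has (fun J => J != 0) s).
  by exists J => //; exact: sJs.
have /colP/(_ (Ordinal d0)) : \sum_(J <- s) J = 0.
  by rewrite big_seq big1// => J /s0 /negPn/eqP.
by rewrite sumJ eZ_same mxE.
Qed.

Lemma sigma2_quad (x : 'cV[R]_d) : (x^T *m sigma2 Js g c *m x) 0 0 =
  \sum_(J <- Js) g J c * (\sum_i (J i 0)%:~R * x i 0) ^+ 2.
Proof.
rewrite /sigma2 mulmx_sumr mulmx_suml summxE; apply: eq_bigr => J _.
rewrite -scalemxAr -scalemxAl mxE; congr (_ * _).
have -> : x^T *m (toR J *m (toR J)^T) *m x = (x^T *m toR J) *m ((toR J)^T *m x).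
  by rewrite !mulmxA.
rewrite mxE big_ord1 expr2; congr (_ * _).
  by rewrite mxE; apply: eq_bigr => i _; rewrite !mxE mulrC.
by rewrite mxE; apply: eq_bigr => i _; rewrite !mxE.
Qed.

Lemma sigma2_sym : symmx (sigma2 Js g c).
Proof.
rewrite /symmx /sigma2 linear_sum/=; apply: eq_bigr => J _.
by rewrite linearZ/= trmx_mul trmxK.
Qed.

(** If the form vanishes at x, then x is orthogonal to every jump, hence to every unit vector, since
    each of these is a sum of jumps. *)
Lemma sigma2_posdef : (forall J, J \in Js -> 0 < g J c) ->
  posdef (sigma2 Js g c).
Proof.
move=> gc x x0; rewrite sigma2_quad.
have ge J : J \in Js -> 0 <= g J c * (\sum_i (J i 0)%:~R * x i 0) ^+ 2.
  by move=> /gc/ltW ?; rewrite mulr_ge0// sqr_ge0.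
rewrite lt_def big_seq sumr_ge0// andbT; apply: contra x0.
rewrite psumr_eq0// => /allP h; apply/eqP/colP => j; rewrite mxE.
have dot0 J : J \in Js -> \sum_i (J i 0)%:~R * x i 0 = 0.
  move=> JJ; have /implyP/(_ JJ) := h J JJ.
  by rewrite mulf_eq0 gt_eqF ?gc//= sqrf_eq0 => /eqP.
have [s [/allP sJs sumJ]] := generating j.
have -> : x j 0 = \sum_i ((eZ j : 'cV[int]_d) i 0)%:~R * x i 0.
  rewrite (bigD1 j)//= eZ_same mul1r big1 ?addr0// => i ij.
  by rewrite eZ_other// mul0r.
rewrite -sumJ (eq_bigr (fun i => \sum_(J <- s) (J i 0)%:~R * x i 0)).
  by rewrite exchange_big/= big_seq big1// => J /sJs /dot0.
by move=> i _; rewrite summxE rmorph_sum/= mulr_suml.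
Qed.

Lemma trace_sigma2 : \tr (sigma2 Js g c) =
  \sum_(J <- Js) g J c * enorm (toR J : 'cV[R]_d) ^+ 2.
Proof.
rewrite /sigma2 linear_sum/=; apply: eq_bigr => J _.
by rewrite linearZ/= mxtrace_mulC /mxtrace big_ord1 -enorm_sqr_mx.
Qed.

End JumpSet.

Lemma C2_on_rate_bounds (R : realType) (d : nat) (Js : seq 'cV[int]_d)
    (g : 'cV[int]_d -> 'cV[R]_d -> R) (c : 'cV[R]_d) (r : R) (J : 'cV[int]_d)
    (B := cball c r)
    (L1 := \big[Num.max/0]_(J <- Js) (sup [set enorm (grad (g J) y) | y in B] / g J c))
    (L2 := \big[Num.max/0]_(J <- Js) (sup [set opnorm (hess (g J) y) | y in B] / g J c)) :
  (0 < d)%N -> 0 < r -> J \in Js -> 0 < g J c -> C2_on B (g J) ->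
  forall y, B y ->
  `|g J y - g J c| <= L1 * g J c * enorm (y - c) /\
  `|g J y - g J c - \sum_j (y - c) j 0 * partial (g J) j c| <=
    L2 * g J c * enorm (y - c) ^+ 2 / 2.
Proof.
move=> d0 r0 JJ gc C2 y By.
have ug := C2_on_grad_bounded r0 C2; have uh := C2_on_hess_bounded d0 r0 C2.
have [U [_ [BU dU]]] := C2.
have df z : B z -> differentiable (g J) z by move=> /BU/dU[].
have d2f z i : B z -> differentiable (partial (g J) i) z.
  by move=> /BU/dU[_ /(_ i)].
split.
  apply: gradient_bound By => // z Bz.
  apply: (@le_trans _ _ (sup [set enorm (grad (g J) y) | y in B])).
    by apply: ub_le_sup => //; exists z.
  rewrite -ler_pdivrMr//.
  exact: (@bigmax_seq_bound _ _ Js (fun J =>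
    sup [set enorm (grad (g J) y) | y in B] / g J c)).
apply: hessian_bound By => // z Bz.
apply: (@le_trans _ _ (sup [set opnorm (hess (g J) y) | y in B])).
  by apply: ub_le_sup => //; exists z.
rewrite -ler_pdivrMr//.
exact: (@bigmax_seq_bound _ _ Js (fun J =>
  sup [set opnorm (hess (g J) y) | y in B] / g J c)).
Qed.

(** In terms of [s = sqrt d] and [r = sqrt n] all powers become integral and both sides are sums of
    four matching terms. The two middle ones agree; the first is compared by [s ^ 2 <= s ^ 3] and
    the last by [18 <= 32]. *)
Lemma error_terms_le (R : realType) (d n : nat)
    (L1 L2 Lmax N1 M v eps del t2 t3 : R) :
  (0 < d)%N -> 0 < n%:R :> R -> 0 <= L1 -> 0 <= L2 -> 0 < Lmax -> 0 <= N1 ->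
  0 <= M -> 0 < v -> 0 < eps -> 0 < del -> 0 < t2 -> 0 <= t3 ->
  n%:R * (L2 / 2 * n%:R^-1 ^+ 2 * Lmax * N1 * t2 * (d%:R * v * n%:R)
    + L1 * n%:R^-1 * Num.sqrt Lmax * M * d%:R * t2 * Num.sqrt (d%:R * v * n%:R)
    + M * (eps * (Num.sqrt d%:R ^+ 3 * t3)
           + 2 * (9 * (d%:R * v / (n%:R * del ^+ 2))) * (d%:R * t2)))
  <= powR d%:R (5 / 2) * (d%:R^-1 * t2) *
     (1 / 2 * L2 * Lmax * v * N1
      + n%:R * M * (L1 * Num.sqrt (v * Lmax) * powR n%:R (- (1 / 2))
         + Num.sqrt d%:R * (powR d%:R (- (3 / 2)) * t3 / (d%:R^-1 * t2)) * eps
         + 32 * Num.sqrt d%:R * v / (n%:R * del ^+ 2))).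
Proof.
move=> d0 n0 L10 L20 Lm0 N10 M0 v0 eps0 del0 t20 t30.
have dR0 : 0 < d%:R :> R by rewrite ltr0n.
have dR1 : 1 <= d%:R :> R by rewrite ler1n.
have -> : Num.sqrt (d%:R * v * n%:R) =
    Num.sqrt d%:R * Num.sqrt v * Num.sqrt n%:R :> R.
  by rewrite !sqrtrM// ?mulr_ge0// ltW.
rewrite (sqrtrM _ (ltW v0)).
have pw (y b : R) (k : nat) : 0 < y -> b = k%:R / 2 -> powR y b = Num.sqrt y ^+ k.
  move=> y0 ->; rewrite -powR12_sqrt ?ltW// -powR_mulrn ?powR_ge0// -powRrM.
  by congr powR; lra.
rewrite !powRN (pw _ (5 / 2) 5%N)// (pw _ (3 / 2) 3%N)// (pw _ (1 / 2) 1%N)// expr1.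
have [ed en] : d%:R = Num.sqrt d%:R ^+ 2 :> R /\ n%:R = Num.sqrt n%:R ^+ 2 :> R.
  by rewrite !sqr_sqrtr// ltW.
have sd1 : 1 <= Num.sqrt d%:R :> R by rewrite -[leLHS]sqrtr1 ler_sqrt.
have sn0 : 0 < Num.sqrt n%:R :> R by rewrite sqrtr_gt0.
move: (Num.sqrt d%:R) (Num.sqrt n%:R) (Num.sqrt v) (sqrtr_ge0 v)
  (Num.sqrt Lmax) (sqrtr_ge0 Lmax) sd1 sn0 ed en => s r w w0 l l0 s1 r0 -> ->.
have s0 : 0 < s by lra.
have [sN rN tN dN] : [/\ s != 0, r != 0, t2 != 0 & del != 0] by rewrite !gt_eqF.
rewrite [leLHS](_ : _ = s ^+ 2 * (L2 / 2 * Lmax * N1 * t2 * v)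
  + L1 * r * l * M * s ^+ 3 * t2 * w + r ^+ 2 * M * eps * s ^+ 3 * t3
  + 18 * (M * s ^+ 4 * v * t2 / del ^+ 2)); last by field; rewrite ?rN ?dN.
rewrite [leRHS](_ : _ = s ^+ 3 * (L2 / 2 * Lmax * N1 * t2 * v)
  + L1 * r * l * M * s ^+ 3 * t2 * w + r ^+ 2 * M * eps * s ^+ 3 * t3
  + 32 * (M * s ^+ 4 * v * t2 / del ^+ 2)); last by field; rewrite ?rN ?sN ?tN ?dN.
apply: lerD; first do 2 apply: lerD => //.
  apply: ler_wpM2r; first by rewrite !mulr_ge0// ltW.
  exact: ler_weXn2l.
apply: ler_wpM2r; last by lra.
by rewrite !mulr_ge0 ?invr_ge0 ?exprn_ge0// ltW.
Qed.

Theorem theorem4p4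
  (R : realType) (d n : nat)
  (Js : seq 'cV[int]_d) (g : 'cV[int]_d -> 'cV[R]_d -> R)
  (c : 'cV[R]_d) (delta0 : R) (Sig S : 'M[R]_d)
  (p : 'cV[int]_d -> R) (eps v delta delta' : R) (h : 'cV[int]_d -> R) :
  let A := DF Js g c in
  let s2 := sigma2 Js g c in
  let B0 := cball c delta0 in
  let dR : R := d%:R in
  let Lmax := lam_max Sig in
  let Sinv := invmx S in                         (* Sigma^{-1/2} *)
  let L0 := \big[Num.max/0]_(J <- Js) (sup [set g J x | x in B0] / g J c) in
  let L1 := \big[Num.max/0]_(J <- Js)
              (sup [set enorm (grad (g J) x) | x in B0] / g J c) in
  let L2 := \big[Num.max/0]_(J <- Js)
              (sup [set opnorm (hess (g J) x) | x in B0] / g J c) in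
  let Lam := dR^-1 * \tr s2 in
  let gam := powR dR (- (3 / 2)) * \sum_(J <- Js) g J c * enorm (toR J) ^+ 3 in
  let Jmax := \big[Num.max/0]_(J <- Js) enorm (Sinv *m toR J) in
  let s2S := Sinv *m s2 *m Sinv in
  let alpha1 := lam_min s2S / 2 in
  let Kstar := Num.sqrt (2 * L0 * \tr s2S / (dR * alpha1)) in
  let dstar := delta0 / Num.sqrt Lmax in
  let th1 := dR^-1 * Num.min (1 / (3 * dR^-1 * Jmax * dstar))
                      (Num.min (1 / (64 * L0 * rho s2 * rho Sig))
                               (1 / (4 * (dR^-1 * Jmax) ^+ 2))) in
  let nstar := powR (dR^-1 * Jmax / dstar) (4 / 3) in
  let K2 := L0 * expR (th1 * (Kstar + dR^-1 * Jmax) ^+ 2) in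
  let n2 := fun T : R => Num.max (K2 * Lam * T) nstar in
  let gsmall := fun j : 'I_d => gext Js g (- eZ j) c in
  let Gbig := fun j : 'I_d => \sum_(i < d | A i j != 0) gext Js g (eZ i) c in
  let gstar := inf [set Num.min (gsmall j) (Gbig j) | j in [set: 'I_d]] in
  let n3 := Num.max (powR (5 * dR^-1 * Jmax * Num.max 1 (Num.sqrt (dR * th1))) (8 / 3))
                    (n2 (1 / gstar)) in
  let nR : R := n%:R in
  (* standing assumptions *)
  (0 < d)%N -> (d ^ 4 <= n)%N ->
  uniq Js -> (forall J x, 0 <= g J x) -> 0 < delta0 ->
  (* (G0) *) Fdrift Js g c = 0 ->
  (* (G1) *) hurwitz A ->
  (* (G2) *) (forall J, J \in Js -> C2_on B0 (g J)) ->
  (* (G3) *) (exists eps0 : R, 0 < eps0 /\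
                forall J, J \in Js -> 0 < g J c /\
                  forall x, B0 x -> eps0 * g J c <= g J x) ->
  (* (G4) *) (forall j : 'I_d, exists s : seq 'cV[int]_d,
                all (fun J => J \in Js) s /\ \sum_(J <- s) J = eZ j) ->
  (* Sigma: the positive definite symmetric solution of the Lyapunov equation *)
  symmx Sig -> posdef Sig -> A *m Sig + Sig *m A^T + s2 = 0 ->
  (* S = Sigma^{1/2}: the positive definite symmetric square root of Sigma *)
  symmx S -> posdef S -> S *m S = Sig ->
  (* W : a random vector in Z^d with law p *)
  is_pmf p -> 0 < eps -> 0 < v ->
  (* (i) *) (\esum_(x in [set: 'cV[int]_d])
                (p x * snorm Sig (toR x - nR *: c) ^+ 2)%:E <= (dR * v * nR)%:E)%E ->
  (* (ii) *) (forall j : 'I_d, (dTV p (shift_pmf p j) <= eps%:E)%E) ->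
  delta <= delta0 / Num.sqrt Lmax -> 0 < delta' -> delta' <= delta / 2 ->
  (* n >= max{n_3, psi^{-1}(delta/2)} (n_3 = +infinity if g_* = 0) *)
  0 < gstar -> n3 <= nR -> psi_inv d th1 (delta / 2) <= nR ->
  `| \sum_(X \in [set X | snorm Sig (toR X - nR *: c) <= nR * delta' / 3])
        (p X * (Agen Js g Sig c n delta h X - Atil s2 A c n h X)) |
  <= powR dR (5 / 2) * Lam *
     (1 / 2 * L2 * Lmax * v * normD1 Sig c n h (nR * delta / 4)
      + nR * normD2 Sig c n h (nR * delta / 4) *
        (L1 * Num.sqrt (v * Lmax) * powR nR (- (1 / 2))
         + Num.sqrt dR * (gam / Lam) * eps
         + 32 * Num.sqrt dR * v / (nR * delta' ^+ 2))).
Proof.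
move=> A s2 B0 dR Lmax Sinv L0 L1 L2 Lam gam Jmax s2S alpha1 Kstar dstar th1
  nstar K2 n2 gsmall Gbig gstar n3 nR d0 dn uJs g0 del0 F0 _ C2 [eps0 [_ G3]] G4
  symSig posSig _ symS posS SS [p0 pmf] eps_gt0 v0 mom tv ddl d'0 d'd _ hn3 hpsi.
have gc J : J \in Js -> 0 < g J c by move=> /G3[].
have n0 : 0 < nR by rewrite ltr0n; apply: leq_trans dn; rewrite expn_gt0 d0.
have dR0 : 0 < dR by rewrite ltr0n.
have dlt0 : 0 < delta by lra.
have Lm0 : 0 < Lmax := lam_max_Sig_gt0 d0 symSig posSig.
have rS1 := posdef_rho_ge1 d0 symSig posSig.
have psig := sigma2_posdef G4 gc.
have r21 : 1 <= rho s2 := posdef_rho_ge1 d0 (sigma2_sym _ _ _) psig.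
have [J0 J0J J0n] := nonzero_jump G4 d0.
(* The centre c lies in the ball, so each supremum is at least [g J c]; one jump is enough for the
   maximum. *)
have L01 : 1 <= L0.
  apply: (@le_trans _ _ (sup [set g J0 y | y in B0] / g J0 c)); last first.
    exact: (@bigmax_seq_bound _ _ Js (fun J => sup [set g J y | y in B0] / g J c)).
  rewrite ler_pdivlMr ?gc// mul1r; apply: ub_le_sup.
    exact: C2_on_rate_bounded del0 (C2 _ J0J).
  by exists c => //; exact: cball_center.
have Jm J : J \in Js -> snorm Sig (toR J) <= Jmax.
  move=> JJ; rewrite (snormE symS posS SS).
  exact: (@bigmax_seq_bound _ _ Js (fun J => enorm (Sinv *m toR J))).
have Jm0 : 0 < Jmax.
  apply: lt_le_trans (Jm _ J0J).
  have e0 : 0 < enorm (toR J0 : 'cV[R]_d).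
    apply: enorm_gt0; apply: contra J0n => /eqP/colP e; apply/eqP/colP => i.
    by have := e i; rewrite !mxE => /eqP; rewrite intr_eq0 => /eqP.
  have := lt_le_trans e0 (enorm_le_snorm d0 symS posS SS symSig posSig (toR J0)).
  by rewrite pmulr_rgt0// sqrtr_gt0.
have dst0 : 0 < dstar by rewrite divr_gt0// sqrtr_gt0.
(* All three denominators must be positive: division by 0 yields 0 and would make [th1] vanish. *)
have T0 : 0 < dR * th1.
  rewrite /th1 mulVKf ?gt_eqF// !lt_min.
  have [l0 r2 rS] : [/\ 0 < L0, 0 < rho s2 & 0 < rho Sig] by split; lra.
  have iJ : 0 < dR^-1 * Jmax by rewrite mulr_gt0// invr_gt0.
  apply/and3P; split; apply: divr_gt0 => //.
  - by rewrite -(mulrA 3) mulr_gt0// mulr_gt0.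
  - by apply: (mulr_gt0 (mulr_gt0 (mulr_gt0 _ l0) r2) rS).
  - by apply: mulr_gt0 => //; apply: exprn_gt0.
(* Only the middle entry of the minimum is kept, and its factor [L0 * rho s2 >= 1] is dropped. *)
have Tr : dR * th1 <= 1 / (64 * rho Sig).
  rewrite /th1 mulVKf ?gt_eqF// !ge_min; apply/orP; right; apply/orP; left.
  have [l0 r2 rS] : [/\ 0 < L0, 0 < rho s2 & 0 < rho Sig] by split; lra.
  have p64 : 0 < 64 :> R by [].
  rewrite !div1r lef_pV2 ?posrE; last 2 first.
  - exact: (mulr_gt0 (mulr_gt0 (mulr_gt0 p64 l0) r2) rS).
  - exact: mulr_gt0 p64 rS.
  apply: ler_wpM2r; first exact: ltW.
  by rewrite -mulrA ler_peMr// -[leLHS]mulr1; apply: ler_pM.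
have hJ : Num.sqrt (rho Sig) * Jmax <= nR * delta / 320.
  apply: scale_bound Tr rS1 (ltW Jm0) dlt0 hpsi _ => //.
  by apply: le_trans hn3; rewrite le_max lexx.
set N := fun X : 'cV[int]_d => snorm Sig (toR X - nR *: c).
have finB a : finite_set [set X : 'cV[int]_d | N X <= a].
  exact: (snorm_ball_finite d0 symS posS SS symSig posSig).
rewrite fsbig_finite; last exact: finB.
set sB := (X in \sum_(_ <- X) _).
have usB : uniq sB by exact: finmap.fset_uniq.
have memB X : (X \in sB) = (N X <= nR * delta' / 3).
  rewrite /sB in_fset_set; last exact: finB.
  by apply/idP/idP => [/set_mem//|XB]; exact: mem_set.
(* Since [delta' <= delta / 2], the distance is at most [n delta / 6 + n delta / 320], which is
   below [n delta / 4]. *)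
have near X J u : J \in Js -> X \in sB ->
    enorm (toR u : 'cV[R]_d) <= enorm (toR J : 'cV[R]_d) ->
    N (X + u) <= nR * delta / 4.
  move=> JJ; rewrite memB => XB uJ.
  have := snorm_le_rho d0 symS posS SS symSig posSig uJ.
  have := ler_wpM2l (sqrtr_ge0 (rho Sig)) (Jm J JJ).
  have := ler_snormD symS posS SS (toR X - nR *: c) (toR u).
  have -> : toR X - nR *: c + toR u = toR (X + u) - nR *: c by rewrite toRD addrAC.
  rewrite -/(N _) -/(N _).
  have : nR * delta' <= nR * (delta / 2) by rewrite ler_pM2l.
  by move: XB hJ (mulr_gt0 n0 dlt0); lra.
have nearB X : X \in sB -> N X <= nR * delta / 4.
  rewrite memB; have : nR * delta' <= nR * (delta / 2) by rewrite ler_pM2l.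
  by move: (mulr_gt0 n0 dlt0); lra.
have q4 : nR * delta / 4 <= nR * delta by move: (mulr_gt0 n0 dlt0); lra.
have AgenE X : X \in sB -> Agen Js g Sig c n delta h X =
    nR * \sum_(J <- Js) g J (nR^-1 *: toR X) * (h (X + J) - h X).
  move=> XB; congr (_ * _); rewrite big_seq [RHS]big_seq.
  apply: eq_bigr => J JJ; rewrite ifT//; apply/andP; split.
    exact: le_trans (nearB _ XB) q4.
  exact: le_trans (near _ _ _ JJ XB (lexx _)) q4.
(* The condition [delta * sqrt Lmax <= delta0] is what places the scaled points in the Euclidean
   ball where the Taylor bounds on the rates hold. *)
have inB0 X : X \in sB -> B0 (nR^-1 *: toR X).
  move=> XB; rewrite /B0 /cball/=.
  have := enorm_le_snorm d0 symS posS SS symSig posSig (toR X - nR *: c).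
  rewrite scaled_center// enormZ gtr0_norm// -scaled_center// -/(N X) => le.
  rewrite -(ler_pM2l n0); apply: le_trans le _.
  have sL0 : 0 < Num.sqrt Lmax by rewrite sqrtr_gt0.
  apply: (@le_trans _ _ (Num.sqrt Lmax * (nR * delta))).
    by rewrite ler_pM2l// (le_trans (nearB _ XB)).
  move: ddl; rewrite ler_pdivlMr// => ddl.
  by rewrite mulrCA ler_pM2l// mulrC.
have mass s : uniq s -> \sum_(X <- s) p X <= 1.
  by move=> us; apply: esum_seq_le => //; rewrite pmf.
have mom2 s : uniq s -> \sum_(X <- s) p X * N X ^+ 2 <= dR * v * nR.
  by move=> us; apply: esum_seq_le.
(* Chebyshev's bound [d v n / (n delta' / 3) ^ 2] for the mass outside the ball. *)
pose tau := 9 * (dR * v / (nR * delta' ^+ 2)).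
have tail s : uniq s -> (forall X, X \in s -> X \notin sB) ->
    \sum_(X <- s) p X <= tau.
  move=> us sN.
  have r0 : 0 < (nR * delta' / 3) ^+ 2 by rewrite exprn_gt0// !mulr_gt0// invr_gt0.
  have : (nR * delta' / 3) ^+ 2 * \sum_(X <- s) p X <= dR * v * nR.
    apply: le_trans (mom2 s us); rewrite mulr_sumr big_seq [leRHS]big_seq.
    apply: ler_sum => X /sN; rewrite memB -ltNge => XN.
    rewrite mulrC ler_wpM2l// ler_pXn2r ?nnegrE ?(ltW XN) ?snorm_ge0//.
    by rewrite !mulr_ge0 ?invr_ge0// ltW.
  rewrite -ler_pdivlMl// => /le_trans; apply.
  rewrite [leLHS](_ : _ = tau)// /tau; field.
  by rewrite !gt_eqF.
have tau0 : 0 <= tau.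
  by rewrite /tau mulr_ge0// divr_ge0// ?mulr_ge0 ?sqr_ge0 ?ltW.
set N1 := normD1 _ _ _ _ _; set M := normD2 _ _ _ _ _.
have M0 : 0 <= M by exact: normD2_ge0.
have N10 : 0 <= N1 by exact: normD1_ge0.
have D2b J u i j X : J \in Js -> X \in sB ->
    enorm (toR u : 'cV[R]_d) <= enorm (toR J : 'cV[R]_d) -> `|D2 h i j (X + u)| <= M.
  by move=> JJ XB uJ; apply: le_normD2; [exact: finB|exact: near uJ].
have D2b0 i j X : X \in sB -> `|D2 h i j X| <= M.
  by move=> XB; apply: le_normD2; [exact: finB|exact: nearB].
have shift J u i j : J \in Js ->
    enorm (toR u : 'cV[R]_d) <= enorm (toR J : 'cV[R]_d) ->
    `|\sum_(X <- sB) p X * (D2 h i j (X + u) - D2 h i j X)| <=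
    M * (2 * l1norm R u * eps + 2 * tau).
  move=> JJ uJ; apply: mean_shift => // X XB; first exact: D2b0.
  exact: D2b uJ.
have main := @mean_generator_diff R d n Js g c Sig h p sB L1 L2 Lmax N1 M
  (dR * v * nR) eps (2 * tau) n0 p0.
rewrite (eq_big_seq (fun X => p X *
    (nR * (\sum_(J <- Js) g J (nR^-1 *: toR X) * (h (X + J) - h X)) -
     Atil s2 A c n h X))); last by move=> X XB; rewrite AgenE.
have t20 : 0 < \tr s2.
  rewrite trace_sigma2 (big_rem J0)//= ltr_pwDl//.
    rewrite mulr_gt0 ?gc// exprn_gt0// enorm_gt0//.
    apply: contra J0n => /eqP/colP e; apply/eqP/colP => i.
    by have := e i; rewrite !mxE => /eqP; rewrite intr_eq0 => /eqP.
  by rewrite big_seq sumr_ge0// => J /mem_rem/gc/ltW ?; rewrite mulr_ge0// sqr_ge0.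
apply: le_trans (error_terms_le d0 n0 _ _ Lm0 N10 M0 v0 eps_gt0 d'0 t20 _); last first.
- by rewrite big_seq sumr_ge0// => J /gc/ltW ?; rewrite mulr_ge0// exprn_ge0// enorm_ge0.
- exact: bigmax_seq_ge0.
- exact: bigmax_seq_ge0.
rewrite trace_sigma2; apply: main => //.
- exact: bigmax_seq_ge0.
- exact: bigmax_seq_ge0.
- exact: ltW.
- by rewrite !mulr_gt0.
- exact: ltW.
- by rewrite mulr_ge0.
- exact: mass.
- exact: mom2.
- by move=> X; exact: (enorm_le_snorm d0 symS posS SS symSig posSig).
- move=> J X JJ XB.
  by have [] := C2_on_rate_bounds d0 del0 JJ (gc _ JJ) (C2 _ JJ) (inB0 _ XB).
- move=> J X JJ XB.
  by have [] := C2_on_rate_bounds d0 del0 JJ (gc _ JJ) (C2 _ JJ) (inB0 _ XB).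
- by move=> i X XB; apply: le_normD1; [exact: finB|exact: nearB].
Qed.
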